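(* For $\alpha\in(0,2)$, $p\in(1,\infty)$, $k\in K_\alpha$, and $u\in L^p(\mathbb{R},|x|^{-\alpha}dx)$, $$\mathcal{E}_{k,p}[u]\ge\int_{\mathbb{R}}|u(x)|^pW_{k,p,1}(x)\,dx+\mathcal{G}_{k,p}(u).$$
   Context: All functions are Borel measurable, $u$ is real-valued, and $q:=p/(p-1)$. For $\alpha\in(0,2)$, $K_\alpha$ is the set of all functions $k:\mathbb{R}^2\to[0,\infty]$ such that $k(x,y)=k(y,x)$ for all $x,y\in\mathbb{R}$; $k(rx,ry)=r^{-\alpha-1}k(x,y)$ for all $x,y\in\mathbb{R}$, $r>0$; and there is a constant $c\in(0,\infty)$ with $k(x,y)\le c|x-y|^{-\alpha-1}$ for all $x,y$. Write $a^{\langle \kappa\rangle}:=|a|^{\kappa}\operatorname{sign}(a)$, $0^{\langle \kappa\rangle}:=0$, and $$\mathcal{E}_{k,p}[u]:=\frac12\int_{\mathbb{R}}\int_{\mathbb{R}}(u(x)-u(y))\big(u(x)^{\langle p-1\rangle}-u(y)^{\langle p-1\rangle}\big)k(x,y)\,dy\,dx\in[0,\infty].$$ For $\rho\in(-1,\alpha)$, $r\in(0,\infty)$ put $$\gamma_+(k,\rho):=\int_0^1(1-t^\rho)(1-t^{\alpha-1-\rho})k(1,t)\,dt,\qquad \gamma_-(k,\rho):=\int_0^1(1-t^\rho)(1-t^{\alpha-1-\rho})k(-1,-t)\,dt,$$ $$C_+(k,r,\rho):=\gamma_+(k,\rho)+\int_0^\infty k(1,-t)\,dt-r\int_0^\infty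 t^\rho k(1,-t)\,dt,$$ $$C_-(k,r,\rho):=\gamma_-(k,\rho)+\int_0^\infty k(-1,t)\,dt-\frac1r\int_0^\infty t^\rho k(-1,t)\,dt ,$$ $$D_\pm(k,p,s,\beta):=\tfrac1p C_\pm\big(k,s^{1/q},\tfrac{\beta}{q}\big)+\tfrac1q C_\pm\big(k,s^{1/p},\tfrac{\beta}{p}\big).$$ For $s\in(0,\infty)$, $W_{k,p,s}(x):=|x|^{-\alpha}D_+(k,p,s,\alpha-1)$ for $x>0$ and $W_{k,p,s}(x):=|x|^{-\alpha}D_-(k,p,s,\alpha-1)$ for $x<0$; here $s=1$. Put $l_p:=\int_0^\infty t^{\frac{\alpha-1}{p}}k(1,-t)\,dt$, $l_q:=\int_0^\infty t^{\frac{\alpha-1}{q}}k(1,-t)\,dt$, $I_+:=\int_0^\infty|u(x)|^p|x|^{-\alpha}dx$, $I_-:=\int_{-\infty}^0|u(x)|^p|x|^{-\alpha}dx$, and $$\mathcal{G}_{k,p}(u):=l_q\Big(\frac{I_+}{p}+\frac{I_-}{q}-I_+^{1/p}I_-^{1/q}\Big)+l_p\Big(\frac{I_+}{q}+\frac{I_-}{p}-I_+^{1/q}I_-^{1/p}\Big).$$ *)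

(* Defs.v *)
From HB Require Import structures.
From mathcomp Require Import all_boot all_order all_algebra.
From mathcomp Require Import all_classical all_reals all_analysis.
From mathcomp Require Import measurable_realfun.
Set Implicit Arguments.
Unset Strict Implicit.
Unset Printing Implicit Defensive.
Import Order.TTheory GRing.Theory Num.Theory.
Import numFieldNormedType.Exports.

Local Open Scope classical_set_scope.
Local Open Scope ring_scope.

(* All integrals are [\bar R]-valued Lebesgue integrals, so that no
   integrability or finiteness convention is built into the definitions. *)

Section hardy.
Context {R : realType}.
Implicit Types (k : R -> R -> \bar R) (u : R -> R) (p r s alpha beta rho : R).

Local Notation mu := (@lebesgue_measure R).

(* The upper bound is required off the diagonal only: for x = y the bound
   c |x - y|^(- alpha - 1) is +oo, whereas [0 `^ a] is 0 for a <> 0. *)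
Definition kernel_class alpha k : Prop :=
  [/\ measurable_fun [set: measurableTypeR R * measurableTypeR R]
        (fun z => k z.1 z.2),
      (forall x y, 0 <= k x y)%E,
      (forall x y, k x y = k y x),
      (forall x y r, 0 < r ->
         k (r * x) (r * y) = ((r `^ (- alpha - 1))%:E * k x y)%E) &
      (exists2 c : R, 0 < c &
         forall x y, x != y ->
           (k x y <= (c * `|x - y| `^ (- alpha - 1))%:E)%E)].

Definition weighted_Lp alpha p u : Prop :=
  measurable_fun [set: measurableTypeR R] u /\
  (\int[mu]_x (`|u x| `^ p * `|x| `^ (- alpha))%:E < +oo)%E.

Definition conj_exp p : R := p / (p - 1).

Definition spow (a kappa : R) : R := `|a| `^ kappa * Num.sg a.

Definition energy k p u : \bar R :=
  ((2^-1)%:E * \int[mu]_x \int[mu]_y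
     (((u x - u y) * (spow (u x) (p - 1) - spow (u y) (p - 1)))%:E * k x y))%E.

Definition gamma_plus alpha k rho : \bar R :=
  (\int[mu]_(t in `]0%R, 1%R[)
     (((1 - t `^ rho) * (1 - t `^ (alpha - 1 - rho)))%:E * k 1%R t))%E.

Definition gamma_minus alpha k rho : \bar R :=
  (\int[mu]_(t in `]0%R, 1%R[)
     (((1 - t `^ rho) * (1 - t `^ (alpha - 1 - rho)))%:E * k (-1)%R (- t)%R))%E.

Definition C_plus alpha k r rho : \bar R :=
  (gamma_plus alpha k rho
   + \int[mu]_(t in `]0%R, +oo[) k 1%R (- t)%R
   - r%:E * \int[mu]_(t in `]0%R, +oo[) ((t `^ rho)%:E * k 1%R (- t)%R))%E.

Definition C_minus alpha k r rho : \bar R :=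
  (gamma_minus alpha k rho
   + \int[mu]_(t in `]0%R, +oo[) k (-1)%R t
   - (r^-1)%:E * \int[mu]_(t in `]0%R, +oo[) ((t `^ rho)%:E * k (-1)%R t))%E.

Definition D_plus alpha k p s beta : \bar R :=
  let q := conj_exp p in
  ((p^-1)%:E * C_plus alpha k (s `^ q^-1) (beta / q)
   + (q^-1)%:E * C_plus alpha k (s `^ p^-1) (beta / p))%E.

Definition D_minus alpha k p s beta : \bar R :=
  let q := conj_exp p in
  ((p^-1)%:E * C_minus alpha k (s `^ q^-1) (beta / q)
   + (q^-1)%:E * C_minus alpha k (s `^ p^-1) (beta / p))%E.

(* The value at the null set {0} is immaterial. *)
Definition W alpha k p s (x : R) : \bar R :=
  if 0 < x then ((`|x| `^ (- alpha))%:E * D_plus alpha k p s (alpha - 1))%E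
  else if x < 0 then
    ((`|x| `^ (- alpha))%:E * D_minus alpha k p s (alpha - 1))%E
  else 0%E.

(* [l_exp alpha k p] is l_p and [l_exp alpha k (conj_exp p)] is l_q. *)
Definition l_exp alpha k p : \bar R :=
  (\int[mu]_(t in `]0%R, +oo[)
     ((t `^ ((alpha - 1) / p))%:E * k 1%R (- t)%R))%E.

Definition I_plus alpha p u : \bar R :=
  (\int[mu]_(x in `]0%R, +oo[) (`|u x| `^ p * `|x| `^ (- alpha))%:E)%E.

Definition I_minus alpha p u : \bar R :=
  (\int[mu]_(x in `]-oo, 0%R[) (`|u x| `^ p * `|x| `^ (- alpha))%:E)%E.

Definition G_remainder alpha k p u : \bar R :=
  let q := conj_exp p in
  let Ip := I_plus alpha p u in
  let Im := I_minus alpha p u in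
  (l_exp alpha k q *
     ((p^-1)%:E * Ip + (q^-1)%:E * Im - poweR Ip p^-1 * poweR Im q^-1)
   + l_exp alpha k p *
     ((q^-1)%:E * Ip + (p^-1)%:E * Im - poweR Ip q^-1 * poweR Im p^-1))%E.

End hardy.

(* Main.v *)
(** Write y = t x in each quadrant of the plane.  By homogeneity of k, the
    double integral over a quadrant becomes the integral against
    k(±1, ±t) dt of the weighted one-dimensional form

      ∫_0^∞ x^(-α) (v(x) - w(tx)) (v(x)^<p-1> - w(tx)^<p-1>) dx.

    Hölder's inequality bounds this from below by the same form evaluated at
    the two numbers ‖v‖ and t^((α-1)/p) ‖w‖, where ‖.‖ is the norm of
    L^p(x^(-α) dx).  For two half-lines of equal sign the result is
    ‖u‖^p (1 - t^((α-1)/p)) (1 - t^((α-1)/q)), and t -> 1/t folds its integral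
    onto (0, 1), giving 2γ.  For opposite signs the cross terms are the ones
    of G, and t -> 1/t exchanges k(1, -t) with k(-1, t).  All the integrals
    of k on the right-hand side are finite, so the remaining comparison is an
    identity between real numbers. *)

Require Import Defs.
From mathcomp Require Import all_boot all_order all_algebra.
From mathcomp Require Import all_classical all_reals all_analysis.
From mathcomp Require Import measurable_realfun.
From mathcomp Require Import ring lra.
Set Implicit Arguments.
Unset Strict Implicit.
Unset Printing Implicit Defensive.
Import Order.TTheory GRing.Theory Num.Theory.
Import numFieldNormedType.Exports.

Local Open Scope classical_set_scope.
Local Open Scope ring_scope.

(** The energy may be infinite and its mixed terms have no sign. The estimates therefore compare
    nonnegative integrands in the extended reals, and terms to be subtracted are first added to the
    other side. Real numbers enter through the kernel constants and through [a], [b] with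
    [I_+ = a^p] and [I_- = b^p].

    Put [rho = (alpha - 1) / p] and [sigma = (alpha - 1) / q]. The proof rests on
    [rho + sigma = alpha - 1] and on [rho] and [sigma] having the same sign. The common sign makes
    [(1 - t^rho) (1 - t^sigma)] nonnegative, and this product vanishes to second order at [t = 1],
    which tames the singularity [|1 - t|^(-alpha - 1)] because [alpha < 2].

    On opposite half-lines the form at the two numbers is [a^p + t^(alpha-1) b^p - a b^(p-1) t^sigma
    - b a^(p-1) t^rho], so [l_q] and [l_p] arise as the integrals of the mixed terms. The potential
    with [s = 1] contains [l_p] and [l_q] with exactly the weights that cancel the parts of G linear
    in [I_+] and [I_-]. *)

Lemma eqW d (T : porderType d) (x y : T) : x = y -> (x <= y)%O.
Proof. by move=> ->. Qed.

(** * Change of variables and Tonelli's theorem on the half-line *)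

Local Notation mfun2 F := (measurable_fun
  [set: measurableTypeR _ * measurableTypeR _] (fun z => F z.1 z.2)).

Section change_of_variables.
Context {R : realType}.
Local Notation mu := (@lebesgue_measure R).
Implicit Types (f : R -> \bar R) (F : R -> R -> \bar R).

Lemma measurable_affine (a b : R) :
  measurable_fun [set: R] (fun x : R => a * x + b : R).
Proof. by apply: measurable_funD => //; apply: measurable_funM. Qed.

(** Multiplied by [c], the pushforward of Lebesgue measure under [x -> c x + b] gives each half-open
    interval its length, so by uniqueness it is Lebesgue measure. *)
Lemma ge0_integral_affine f (c b : R) : 0 < c ->
  measurable_fun [set: R] f -> (forall x, 0 <= f x)%E ->
  (\int[mu]_x f (c * x + b)%R = (c^-1)%:E * \int[mu]_x f x)%E.
Proof.
move=> c0 mf f0.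
pose phi : R -> measurableTypeR R := fun x => (c * x + b)%R.
have mphi : measurable_fun [set: measurableTypeR R] phi
  by exact: measurable_affine.
have cn0 : 0 <= c by exact: ltW.
have nuE (m : measurable_fun [set: measurableTypeR R] phi) A : measurable A ->
    mu A = mscale (NngNum cn0)
      (measure_function_pushforward__canonical__measure_function_Measure mu m)
      A.
  apply: lebesgue_measure_unique => _ [[x y]] _ <-.
  rewrite -[RHS]/(c%:E * mu (phi @^-1` `]x, y]%classic))%E.
  rewrite (_ : phi @^-1` _ = `](x - b) / c, (y - b) / c]%classic); last first.
    apply/seteqP; split => z /=; rewrite !in_itv/= /phi.
      by rewrite ltr_pdivrMr// ler_pdivlMr// ltrBlDr lerBrDr mulrC.
    by rewrite ltr_pdivrMr// ler_pdivlMr// ltrBlDr lerBrDr mulrC.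
  rewrite !lebesgue_measure_itv/= !lte_fin ltr_pM2r ?invr_gt0// ltrD2r.
  case: ifP => _; last by rewrite mule0.
  rewrite -!EFinB -EFinM; congr EFin.
  by rewrite -mulrBl mulrCA divff ?gt_eqF// mulr1; ring.
rewrite [in RHS](eq_measure_integral _ (fun A mA _ => nuE mphi A mA)).
rewrite ge0_integral_mscale//= ge0_integral_pushforward//=.
by rewrite muleA -EFinM mulVf ?gt_eqF// mul1e.
Qed.

Lemma ge0_integral_opp f : measurable_fun [set: R] f ->
  (forall x, 0 <= f x)%E ->
  (\int[mu]_x f (- x)%R = \int[mu]_x f x)%E.
Proof.
move=> mf f0.
pose phi : R -> measurableTypeR R := -%R.
have mphi : measurable_fun [set: measurableTypeR R] phi.
  exact: oppr_measurable.
have phiE A : measurable A -> mu A =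
    (measure_function_pushforward__canonical__measure_function_Measure mu mphi)
      A.
  by move=> mA; rewrite -[RHS]/(pushforward mu phi A) lebesgue_measureN.
rewrite [in RHS](eq_measure_integral _ (fun A mA _ => phiE A mA)).
by rewrite ge0_integral_pushforward//=.
Qed.

Lemma ge0_integral_pos_scale f (c : R) : 0 < c ->
  measurable_fun [set: R] f -> (forall x : R, 0 < x -> (0 <= f x)%E) ->
  (\int[mu]_(x in `]0%R, +oo[) f (c * x)%R =
   (c^-1)%:E * \int[mu]_(x in `]0%R, +oo[) f x)%E.
Proof.
move=> c0 mf f0; rewrite [LHS]integral_mkcond [in RHS]integral_mkcond.
rewrite -(@ge0_integral_affine _ c 0)//.
- apply: eq_integral => x _; rewrite addr0 /patch !mem_setE !in_itv/= !andbT.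
  by rewrite pmulr_rgt0.
- by apply/(measurable_restrictT _ _).1 => //; exact: measurable_funTS.
- move=> x; rewrite /patch mem_setE in_itv/= andbT.
  by case: ifP => // x0; exact: f0.
Qed.

Lemma ge0_integral_neg_pos f : measurable_fun [set: R] f ->
  (forall x, 0 <= f x)%E ->
  (\int[mu]_(x in `]-oo, 0%R[) f x = \int[mu]_(x in `]0%R, +oo[) f (- x)%R)%E.
Proof.
move=> mf f0.
rewrite [LHS]integral_mkcond [in RHS]integral_mkcond -[LHS]ge0_integral_opp.
- apply: eq_integral => x _; rewrite /patch !mem_setE !in_itv/= !andbT.
  by rewrite oppr_lt0.
- by apply/(measurable_restrictT _ _).1 => //; exact: measurable_funTS.
- by move=> x; apply: erestrict_ge0.
Qed.

Lemma ge0_integral_pos_neg f : measurable_fun [set: R] f ->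
  (forall x, 0 <= f x)%E ->
  (\int[mu]_x f x = \int[mu]_(x in `]0%R, +oo[) f x
    + \int[mu]_(x in `]0%R, +oo[) f (- x)%R)%E.
Proof.
move=> mf f0; rewrite -ge0_integral_neg_pos//.
have -> : [set: R] = `]-oo, 0[ `|` `[0, +oo[.
  by rewrite -[RHS]itv_bndbnd_setU// set_itvNyy.
rewrite ge0_integral_setU//=.
- by rewrite -integral_itv_obnd_cbnd 1?addeC//; exact: measurable_funTS.
- exact: measurable_funTS.
- apply/disj_setPLR => x /=; rewrite !in_itv/= andbT.
  by move=> x0; apply/negP; rewrite -ltNge.
Qed.

(** Extension by zero off the open quadrant makes Tonelli's theorem on the plane available for
    integrands whose sign is known only on that quadrant. *)
Lemma mfun2_patch F : mfun2 F ->
  measurable_fun [set: measurableTypeR R * measurableTypeR R]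
    (fun z => if (0 < z.1) && (0 < z.2) then F z.1 z.2 else 0%E).
Proof.
move=> mF.
rewrite [X in measurable_fun _ X](_ : _ =
    (fun z => F z.1 z.2) \_ (`]0, +oo[ `*` `]0, +oo[)).
  apply/(measurable_restrictT _ _).1; last exact: measurable_funTS.
  by apply: measurableX.
apply/funext => -[x y]; rewrite /patch/=.
by rewrite in_setX !mem_setE/= !in_itv/= !andbT.
Qed.

Lemma int_int_patch F : (\int[mu]_x \int[mu]_y
    (if ((0 < x) && (0 < y))%R then F x y else 0) =
  \int[mu]_(x in `]0%R, +oo[) \int[mu]_(y in `]0%R, +oo[) F x y)%E.
Proof.
rewrite [RHS]integral_mkcond; apply: eq_integral => x _.
rewrite /patch mem_setE in_itv/= andbT.
case: ifPn => x0; last by rewrite integral0.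
rewrite [RHS]integral_mkcond; apply: eq_integral => y _.
by rewrite /patch mem_setE in_itv/= andbT.
Qed.

Lemma tonelli_pos F : mfun2 F ->
  (forall x y : R, 0 < x -> 0 < y -> (0 <= F x y)%E) ->
  (\int[mu]_(x in `]0%R, +oo[) \int[mu]_(y in `]0%R, +oo[) F x y =
   \int[mu]_(y in `]0%R, +oo[) \int[mu]_(x in `]0%R, +oo[) F x y)%E.
Proof.
move=> mF F0; rewrite -int_int_patch -(int_int_patch (fun y x => F x y)).
rewrite (@fubini_tonelli _ _ _ _ _ mu mu
  (fun z => if (0 < z.1) && (0 < z.2) then F z.1 z.2 else 0%E))/=.
- by apply: eq_integral => x _; apply: eq_integral => y _; rewrite andbC.
- exact: mfun2_patch.
- by move=> [x y]/=; case: ifP => // /andP[]; exact: F0.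
Qed.

Lemma measurable_int_pos F : mfun2 F ->
  (forall x y : R, 0 < x -> 0 < y -> (0 <= F x y)%E) ->
  measurable_fun (`]0, +oo[%classic : set R)
    (fun x => \int[mu]_(y in `]0%R, +oo[) F x y)%E.
Proof.
move=> mF F0; apply/(measurable_restrictT _ _).2 => //.
have := @measurable_fun_fubini_tonelli_F _ _ _ _ _ mu _
  (mfun2_patch mF).
rewrite /fubini_F/= => mG.
rewrite [X in measurable_fun _ X](_ : _ = (fun x => \int[mu]_y
    (if ((0 < x) && (0 < y))%R then F x y else 0))%E).
  by apply: mG => -[x y]/=; case: ifP => // /andP[]; exact: F0.
apply/funext => x; rewrite /patch mem_setE in_itv/= andbT.
case: ifPn => x0; last by rewrite integral0.
rewrite [LHS]integral_mkcond; apply: eq_integral => y _.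
by rewrite /patch mem_setE in_itv/= andbT.
Qed.

End change_of_variables.

(** * Polar form of a double integral and inversion of the half-line *)

Section power_kernels.
Context {R : realType}.
Local Notation mu := (@lebesgue_measure R).
Implicit Types (f : R -> \bar R) (F : R -> R -> \bar R).

Lemma mfun2_powR_div f (b c : R) : measurable_fun [set: R] f ->
  mfun2 (fun x y => f (x `^ b * y `^ c)).
Proof.
move=> mf; apply: (measurableT_comp mf); apply: measurable_funM.
  by apply: (measurableT_comp (measurable_powR b)); exact: measurable_fst.
by apply: (measurableT_comp (measurable_powR c)); exact: measurable_snd.
Qed.

Lemma mfun2_powR_mul F (a b c : R) : mfun2 F ->
  mfun2 (fun x y => (x `^ a)%:E * F x (x `^ b * y `^ c)%R)%E.
Proof.
move=> mF; apply: emeasurable_funM.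
  apply: measurableT_comp => //.
  by apply: (measurableT_comp (measurable_powR a)); exact: measurable_fst.
apply: (@measurableT_comp _ _ _ _ _ _ (fun z => F z.1 z.2) _
  (fun z : measurableTypeR R * measurableTypeR R =>
     (z.1, z.1 `^ b * z.2 `^ c) : measurableTypeR R * measurableTypeR R)) => //.
apply/measurable_fun_pairP; split => /=; first exact: measurable_fst.
apply: measurable_funM.
  by apply: (measurableT_comp (measurable_powR b)); exact: measurable_fst.
by apply: (measurableT_comp (measurable_powR c)); exact: measurable_snd.
Qed.

Lemma tonelli_polar F : mfun2 F ->
  (forall x y : R, 0 < x -> 0 < y -> (0 <= F x y)%E) ->
  (\int[mu]_(x in `]0%R, +oo[) \int[mu]_(y in `]0%R, +oo[) F x y =
   \int[mu]_(t in `]0%R, +oo[) \int[mu]_(x in `]0%R, +oo[)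
     (x%:E * F x (x * t)%R))%E.
Proof.
move=> mF F0.
(* The exponents 1 bring the integrand into the shape of [mfun2_powR_mul]. For negative [x] the
   power is not [x], hence [GE] is restricted to positive arguments. *)
pose G x t := ((x `^ 1)%:E * F x (x `^ 1 * t `^ 1)%R)%E.
have GE (x t : R) : 0 < x -> 0 < t -> G x t = (x%:E * F x (x * t)%R)%E.
  by move=> x0 t0; rewrite /G !powRr1 ?ltW.
have mG : mfun2 G by exact: mfun2_powR_mul.
have G0 (x t : R) : 0 < x -> 0 < t -> (0 <= G x t)%E.
  move=> x0 t0; rewrite GE// mule_ge0//; first by rewrite lee_fin ltW.
  by apply: F0 => //; exact: mulr_gt0.
transitivity (\int[mu]_(x in `]0%R, +oo[) \int[mu]_(t in `]0%R, +oo[) G x t)%E.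
  apply: eq_integral => x; rewrite mem_setE in_itv/= andbT => x0.
  have mFx : measurable_fun [set: R] (F x).
    exact: (measurableT_comp mF (pair1_measurable x)).
  transitivity (x%:E * \int[mu]_(t in `]0%R, +oo[) F x (x * t)%R)%E.
    rewrite ge0_integral_pos_scale//; last by move=> y y0; exact: F0.
    by rewrite muleA -EFinM divff ?gt_eqF// mul1e.
  rewrite -ge0_integralZl//=.
  - apply: eq_integral => t; rewrite mem_setE in_itv/= andbT => t0.
    by rewrite GE.
  - apply: measurable_funTS; apply: (measurableT_comp mFx).
    exact: measurable_funM.
  - by move=> t; rewrite in_itv/= andbT => t0; apply: F0 => //; exact: mulr_gt0.
  - by rewrite lee_fin ltW.
rewrite (tonelli_pos mG G0); apply: eq_integral => t.
rewrite mem_setE in_itv/= andbT => t0; apply: eq_integral => x.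
by rewrite mem_setE in_itv/= andbT => x0; rewrite GE.
Qed.

(* Both sides are the two iterated integrals of 1_(0,1](x) x^-1 f(y / x), the
   inner variable being rescaled by the outer one.  The inverse is written as a
   power because [powR] is known to be measurable on the whole line. *)
Lemma ge0_integral_inv f : measurable_fun [set: R] f ->
  (forall x : R, 0 < x -> (0 <= f x)%E) ->
  (\int[mu]_(t in `]0%R, +oo[) f t =
   \int[mu]_(t in `]0%R, +oo[) ((t `^ (- 2))%:E * f (t `^ (- 1))%R))%E.
Proof.
move=> mf f0.
pose phi (x : R) : R := \1_(`]0, 1]%classic : set R) x.
have mphi : measurable_fun [set: R] phi by exact: measurable_indic.
have phi0 (x : R) : 0 <= phi x by rewrite /phi indicE.
have iphi : (\int[mu]_(x in `]0%R, +oo[) (phi x)%:E = 1)%E.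
  rewrite integral_indic//= setIidl; last first.
    by move=> x /=; rewrite !in_itv/= => /andP[->].
  by rewrite lebesgue_measure_itv/= lte_fin ltr01 oppr0 adde0.
pose F (x y : R) := ((phi x * x `^ (- 1))%:E * f (x `^ (- 1) * y `^ 1)%R)%E.
pose K (y s : R) := ((phi (y * s) * s `^ (- 1))%:E * f (s `^ (- 1))%R)%E.
have powRV (x : R) : 0 < x -> x `^ (- 1) = x^-1.
  by move=> x0; rewrite powR_inv1// ltW.
have mF : mfun2 F.
  apply: emeasurable_funM; last exact: mfun2_powR_div.
  apply: measurableT_comp => //.
  apply: measurable_funM; first exact: (measurableT_comp mphi).
  by apply: (measurableT_comp (measurable_powR _)); exact: measurable_fst.
have F0 (x y : R) : 0 < x -> 0 < y -> (0 <= F x y)%E.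
  move=> x0 y0; apply: mule_ge0; first by rewrite lee_fin mulr_ge0// powR_ge0.
  by apply: f0; rewrite mulr_gt0// powR_gt0.
have mK : mfun2 K.
  apply: emeasurable_funM.
    apply: measurableT_comp => //.
    apply: measurable_funM.
      apply: (measurableT_comp mphi); apply: measurable_funM.
        exact: measurable_fst.
      exact: measurable_snd.
    by apply: (measurableT_comp (measurable_powR _)); exact: measurable_snd.
  apply: (measurableT_comp mf).
  by apply: (measurableT_comp (measurable_powR _)); exact: measurable_snd.
have K0 (x y : R) : 0 < x -> 0 < y -> (0 <= K x y)%E.
  move=> x0 y0; apply: mule_ge0; first by rewrite lee_fin mulr_ge0// powR_ge0.
  by apply: f0; rewrite powR_gt0.
transitivity (\int[mu]_(x in `]0%R, +oo[) \int[mu]_(y in `]0%R, +oo[) F x y)%E.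
  (* For fixed [x] the dilation yields a factor [x] that cancels the [x^-1] of [F]. What remains is
     the integral of [f] times the weight [phi], of total mass 1. *)
  transitivity (\int[mu]_(x in `]0%R, +oo[)
     ((\int[mu]_(t in `]0%R, +oo[) f t) * (phi x)%:E))%E.
    rewrite ge0_integralZl//= ?iphi ?mule1//.
    - by apply: measurable_funTS; exact: measurableT_comp.
    - by move=> x _; rewrite lee_fin.
    - by apply: integral_ge0 => x /=; rewrite in_itv/= andbT; exact: f0.
  apply: eq_integral => x; rewrite mem_setE in_itv/= andbT => x0.
  rewrite /F ge0_integralZl//=; last 3 first.
  - apply: measurable_funTS; apply: (measurableT_comp mf).
    apply: measurable_funM => //; exact: measurable_powR.
  - move=> y; rewrite in_itv/= andbT => y0.
    by apply: f0; rewrite mulr_gt0// powR_gt0.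
  - by rewrite lee_fin mulr_ge0// powR_ge0.
  rewrite [X in _ = (_ * X)%E](_ : _ =
     (\int[mu]_(y in `]0%R, +oo[) f (x `^ (- 1) * y)%R)%E); last first.
    apply: eq_integral => y; rewrite mem_setE in_itv/= andbT => y0.
    by rewrite powRr1 ?ltW.
  rewrite ge0_integral_pos_scale ?powR_gt0// muleA -EFinM muleC.
  by rewrite -mulrA divff ?mulr1// gt_eqF// powR_gt0.
rewrite (tonelli_pos mF F0).
transitivity (\int[mu]_(y in `]0%R, +oo[) \int[mu]_(s in `]0%R, +oo[) K y s)%E.
  apply: eq_integral => y; rewrite mem_setE in_itv/= andbT => y0.
  have mFy : measurable_fun [set: R] (fun x => F x y).
    exact: (measurableT_comp mF (pair2_measurable y)).
  have -> : (\int[mu]_(x in `]0%R, +oo[) F x y =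
      y%:E * \int[mu]_(x in `]0%R, +oo[) F (y * x)%R y)%E.
    rewrite (@ge0_integral_pos_scale _ (fun x => F x y))//; last first.
      by move=> x x0; exact: F0.
    by rewrite muleA -EFinM divff ?gt_eqF// mul1e.
  rewrite -ge0_integralZl//=; last 3 first.
  - by apply: measurable_funTS; apply: (measurableT_comp mFy);
      exact: measurable_funM.
  - by move=> x; rewrite in_itv/= andbT => x0; apply: F0 => //; exact: mulr_gt0.
  - by rewrite lee_fin ltW.
  apply: eq_integral => s; rewrite mem_setE in_itv/= andbT => s0.
  have ys0 : 0 < y * s by exact: mulr_gt0.
  rewrite /F /K !powRV// powRr1 ?ltW// muleA -EFinM; congr (_%:E * f _)%E.
    by rewrite invfM mulrCA; congr (_ * _); rewrite mulrA divff ?mul1r// gt_eqF.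
  by rewrite invfM mulrC mulrA divff ?mul1r// gt_eqF.
rewrite (tonelli_pos mK K0); apply: eq_integral => s.
rewrite mem_setE in_itv/= andbT => s0.
(* For fixed [s] the integral of [phi (s y)] in [y] is [s^-1]. Together with the [s^-1] in [K] it
   forms the Jacobian [s^-2]. *)
transitivity (\int[mu]_(y in `]0%R, +oo[)
  (((s `^ (- 1))%:E * f (s `^ (- 1))%R) * (phi (s * y)%R)%:E))%E.
  apply: eq_integral => y _.
  by rewrite /K EFinM muleAC -muleA muleC (mulrC s) [in LHS](muleC (f _)).
have msphi : measurable_fun [set: R] (fun y => (phi (s * y)%R)%:E).
  apply: measurableT_comp => //; apply: (measurableT_comp mphi).
  exact: measurable_funM.
rewrite ge0_integralZl//=.
- rewrite (@ge0_integral_pos_scale _ (EFin \o phi))//=.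
  - rewrite iphi mule1 muleAC -EFinM -powRV// -powRD; last first.
      by apply/implyP => _; rewrite gt_eqF.
    by rewrite -opprD.
  - exact: measurableT_comp.
  - by move=> x _; rewrite lee_fin.
- exact: measurable_funTS.
- by move=> x _; rewrite lee_fin.
- by apply: mule_ge0; rewrite ?lee_fin ?powR_ge0// f0// powR_gt0.
Qed.

End power_kernels.

(** * Integrals of powers *)

Section power_integrals.
Context {R : realType}.
Local Notation mu := (@lebesgue_measure R).
Implicit Types (f : R -> \bar R) (a b c t x : R).

Lemma powRN_cvgy0 c : 0 < c -> x `^ (- c) @[x --> +oo] --> (0 : R).
Proof.
move=> c0; apply/cvgrPdist_le => /= e e0; near=> x.
(* The threshold is the solution of [x^(-c) = e]. *)
have M0 : 0 < (e^-1) `^ c^-1 by rewrite powR_gt0 ?invr_gt0.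
have Mx : (e^-1) `^ c^-1 <= x by near: x; exact: nbhs_pinfty_ge.
have x0 : 0 < x by exact: lt_le_trans Mx.
rewrite sub0r normrN ger0_norm ?powR_ge0// powRN -[leRHS]invrK.
rewrite lef_pV2 ?posrE ?powR_gt0 ?invr_gt0//.
rewrite -[leLHS]powRr1; last by rewrite invr_ge0 ltW.
rewrite -(mulVf (lt0r_neq0 c0)) powRrM.
by apply: ge0_ler_powR => //; rewrite ?nnegrE ltW.
Unshelve. all: by end_near. Qed.

Lemma continuous_powR_pos c x : 0 < x ->
  {for x, continuous (fun y : R => y `^ c)}.
Proof.
move=> x0; apply: differentiable_continuous; apply/derivable1_diffP.
by apply: derivable_powR; rewrite in_itv/= andbT.
Qed.

Lemma integral_powR_tail b : 1 < b ->
  (\int[mu]_(x in `[1%R, +oo[) (x `^ (- b))%:E < +oo)%E.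
Proof.
move=> b1.
have b0 : b - 1 != 0 by rewrite gt_eqF// subr_gt0.
pose F x := (1 - b)^-1 * x `^ (- (b - 1)).
have dF x : 0 < x -> is_derive x (1 : R) F (x `^ (- b)).
  move=> x0.
  have -> : x `^ (- b) = (1 - b)^-1 *: ((- (b - 1)) * x `^ (- (b - 1) - 1)).
    rewrite opprB /GRing.scale/= mulrA mulVf ?mul1r; last first.
      by rewrite -opprB oppr_eq0.
    by congr powR; ring.
  exact: (@is_deriveZ _ _ _ (fun y : R => y `^ (- (b - 1))) (1 - b)^-1 x 1 _
    (is_derive1_powR _ x0)).
rewrite (@ge0_continuous_FTC2y _ _ F _ 0).
- by rewrite -EFinB ltry.
- by move=> x _; exact: powR_ge0.
- apply: continuous_in_subspaceT => x; rewrite mem_setE in_itv/= andbT => x1.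
  by apply: continuous_powR_pos; exact: lt_le_trans x1.
- rewrite -(mulr0 (1 - b)^-1); apply: cvgMr.
  by apply: powRN_cvgy0; rewrite subr_gt0.
- by move=> x x1; apply: ex_derive; apply: dF; exact: lt_trans x1.
- apply: cvg_at_right_filter; apply: cvgMr; exact: continuous_powR_pos.
- move=> x; rewrite in_itv/= andbT => x1; rewrite derive1E.
  by apply: derive_val; apply: dF; exact: lt_trans x1.
Qed.

(** Writes an integral over the unit interval as one over the half-line, the form to which the
    inversion [t -> 1/t] applies. *)
Lemma integral_pos_if_lt1 f :
  (\int[mu]_(x in `]0%R, +oo[) (if (x < 1)%R then f x else 0) =
   \int[mu]_(x in `]0%R, 1%R[) f x)%E.
Proof.
rewrite [LHS]integral_mkcond [RHS]integral_mkcond.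
apply: eq_integral => x _; rewrite /patch !mem_setE !in_itv/= andbT.
by case: ltP => //; case: ltP.
Qed.

Lemma measurable_if_lt1 f : measurable_fun [set: R] f ->
  measurable_fun [set: R] (fun x => if (x < 1)%R then f x else 0%E).
Proof.
move=> mf; apply: measurable_fun_ifT => //.
exact: measurable_fun_ltr.
Qed.

Lemma measurable_EFin_powR a :
  measurable_fun [set: R] (fun x : R => (x `^ a)%:E).
Proof. by apply: measurableT_comp => //; exact: measurable_powR. Qed.

(** Inversion turns the singularity at 0 into the tail of [t^(-(a + 2))] on [(1, +oo)], and
    [a + 2 > 1]. *)
Lemma integral_powR_unit a : - 1 < a ->
  (\int[mu]_(x in `]0%R, 1%R[) (x `^ a)%:E < +oo)%E.
Proof.
move=> a1.
rewrite -integral_pos_if_lt1 ge0_integral_inv; last 2 first.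
- by apply: measurable_if_lt1; exact: measurable_EFin_powR.
- by move=> x _; case: ifP => // _; rewrite lee_fin powR_ge0.
apply: (@le_lt_trans _ _ (\int[mu]_(x in `[1%R, +oo[) (x `^ (- (a + 2)))%:E)%E);
  last by apply: integral_powR_tail; lra.
rewrite [leLHS]integral_mkcond [leRHS]integral_mkcond.
apply: ge0_le_integral => //.
- move=> t _; apply: erestrict_ge0 => x _; apply: mule_ge0.
    by rewrite lee_fin powR_ge0.
  by case: ifP => // _; rewrite lee_fin powR_ge0.
- apply/(measurable_restrictT _ _).1 => //; apply: measurable_funTS.
  apply: emeasurable_funM; first exact: measurable_EFin_powR.
  apply: (measurableT_comp (measurable_if_lt1 (measurable_EFin_powR a))).
  exact: measurable_powR.
- apply/(measurable_restrictT _ _).1 => //; apply: measurable_funTS.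
  exact: measurable_EFin_powR.
- move=> x _; rewrite /patch !mem_setE !in_itv/= !andbT.
  have [x0|x0] := ltP 0 x; last by case: ifP => // _; rewrite lee_fin powR_ge0.
  rewrite powR_inv1; last exact: ltW.
  rewrite invf_lt1//.
  have [x1|x1] := ltP 1 x; last first.
    by rewrite mule0; case: ifP => // _; rewrite lee_fin powR_ge0.
  rewrite (ltW x1) -EFinM -powR_inv1; last exact: ltW.
  rewrite -powRrM -powRD; last first.
    by apply/implyP => _; rewrite gt_eqF.
  by have -> : - 2 + - 1 * a = - (a + 2) by ring.
Qed.

End power_integrals.

(** * Integrability of powers against kernels with a power bound *)

Section kernel_integrals.
Context {R : realType}.
Local Notation mu := (@lebesgue_measure R).
Implicit Types (f : R -> \bar R) (a c t x alpha rho sigma : R).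

Lemma integral_powR_onem_unit a : - 1 < a ->
  (\int[mu]_(x in `]0%R, 1%R[) ((1 - x) `^ a)%:E < +oo)%E.
Proof.
move=> a1.
pose g := (fun x : R => (x `^ a)%:E) \_ (`]0, 1[%classic : set R).
have mg : measurable_fun [set: R] g.
  apply/(measurable_restrictT _ _).1 => //; apply: measurable_funTS.
  exact: measurable_EFin_powR.
have g0 x : (0 <= g x)%E.
  by apply: erestrict_ge0 => y _; rewrite lee_fin powR_ge0.
have mg1 : measurable_fun [set: R] (fun x => g (1 * x + 1)).
  exact: (measurableT_comp mg (measurable_affine 1 1)).
rewrite [ltLHS](_ : _ = \int[mu]_(x in `]0%R, 1%R[) (x `^ a)%:E)%E;
  last first.
  rewrite [LHS]integral_mkcond [RHS]integral_mkcond -/g.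
  (* The affine substitution asks for a positive slope, so [x -> 1 - x] is composed of a translation
     and a reflection. *)
  transitivity (\int[mu]_x g (1 * x + 1)%R)%E; last first.
    by rewrite ge0_integral_affine// invr1 mul1e.
  rewrite -[RHS](ge0_integral_opp mg1); last by move=> x; exact: g0.
  apply: eq_integral => x _.
  have -> : 1 * - x + 1 = 1 - x by ring.
  by rewrite /g /patch !mem_setE !in_itv/= subr_gt0 gtrBl andbC.
exact: integral_powR_unit.
Qed.

(** On [(0, 1)] the decay factor is at most 1 and [a > -1] suffices. On [[1, +oo)] it is at most
    [t^(-alpha-1)] and [a < alpha] suffices. *)
Lemma integral_powR_decay_lty f c alpha a : measurable_fun [set: R] f ->
  (forall t, 0 < t -> (0 <= f t <= (c * (1 + t) `^ (- alpha - 1))%:E)%E) ->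
  0 < c -> 0 < alpha -> - 1 < a < alpha ->
  (\int[mu]_(t in `]0%R, +oo[) ((t `^ a)%:E * f t) < +oo)%E.
Proof.
move=> mf fb c0 al0 /andP[a1 aal].
have mpf : measurable_fun [set: R] (fun t => (t `^ a)%:E * f t)%E.
  by apply: emeasurable_funM => //; exact: measurable_EFin_powR.
have pf0 t : 0 < t -> (0 <= (t `^ a)%:E * f t)%E.
  by move=> /fb/andP[f0 _]; rewrite mule_ge0// lee_fin powR_ge0.
have bound (A : set R) (b : R) : measurable A -> A `<=` `]0, +oo[ ->
    (forall t, A t -> t `^ a * (1 + t) `^ (- alpha - 1) <= t `^ b) ->
    (\int[mu]_(t in A) (t `^ b)%:E < +oo)%E ->
    (\int[mu]_(t in A) ((t `^ a)%:E * f t) < +oo)%E.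
  move=> mA A0 Ab Aoo.
  have Apos t : A t -> 0 < t by move/A0; rewrite /= in_itv/= andbT.
  apply: (@le_lt_trans _ _ (\int[mu]_(t in A) (c%:E * (t `^ b)%:E))%E).
    apply: ge0_le_integral => //.
    - by move=> t /Apos; exact: pf0.
    - exact: measurable_funTS.
    - by apply: measurable_funTS; apply: measurable_funeM;
        exact: measurable_EFin_powR.
    - move=> t At; have /andP[_ ft] := fb _ (Apos _ At).
      apply: (le_trans (lee_wpmul2l _ ft)); first by rewrite lee_fin powR_ge0.
      by rewrite -!EFinM lee_fin mulrCA ler_pM2l// Ab.
  rewrite ge0_integralZl//=.
  - by rewrite lte_mul_pinfty// lee_fin ltW.
  - by apply: measurable_funTS; exact: measurable_EFin_powR.
  - by move=> t _; rewrite lee_fin powR_ge0.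
  - by rewrite lee_fin ltW.
have -> : `]0, +oo[%classic = `]0, 1[ `|` `[1, +oo[ :> set R.
  by rewrite -itv_bndbnd_setU// bnd_simp.
rewrite ge0_integral_setU//=.
- apply: lte_add_pinfty.
    apply: (bound _ a) => //.
    + by move=> t /=; rewrite !in_itv/= andbT => /andP[].
    + move=> t /=; rewrite in_itv/= => /andP[t0 _].
      rewrite -[leRHS]mulr1 ler_wpM2l ?powR_ge0//.
      by rewrite -[leRHS](powRr0 (1 + t)) ler_powR//; lra.
    + exact: integral_powR_unit.
  apply: (bound _ (- (alpha + 1 - a))) => //.
  + by move=> t /=; rewrite !in_itv/= !andbT; exact: lt_le_trans.
  + move=> t /=; rewrite in_itv/= andbT => t1.
    have t0 : 0 < t by exact: lt_le_trans t1.
    have -> : - (alpha + 1 - a) = a + - (alpha + 1) by ring.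
    rewrite powRD; last by apply/implyP => _; rewrite gt_eqF.
    rewrite ler_wpM2l ?powR_ge0//.
    rewrite -opprD !powRN lef_pV2 ?posrE ?powR_gt0//; last lra.
    by apply: ge0_ler_powR; rewrite ?nnegrE; lra.
  + by apply: integral_powR_tail; lra.
- exact: measurable_funTS.
- by move=> t /= []; rewrite in_itv/= => /andP[t0 t1]; apply: pf0 => //;
    exact: lt_le_trans t0.
- apply/disj_setPLR => t /=; rewrite !in_itv/= andbT => /andP[_ t1].
  by apply/negP; rewrite -ltNge.
Qed.

Lemma onem_powR_bounds t a : 0 < t < 1 -> 0 <= a <= 1 ->
  0 <= 1 - t `^ a <= 1 - t.
Proof.
move=> /andP[t0 t1] /andP[a0 a1].
have t01 : 0 < t <= 1 by rewrite t0 ltW.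
rewrite subr_ge0 -[leRHS](powRr0 t) (ger_powR t01 a0)/=.
by rewrite lerD2l lerN2 ger1_powR.
Qed.

(** Nonnegative exponents with sum below 1 are each at most 1, so each factor lies between 0 and
    [1 - t]. Nonpositive exponents reduce to this case by extracting [t^(rho + sigma)]; the factor
    [1 + t^(rho + sigma)] covers both cases. *)
Lemma onem_powR_mul_bounds t rho sigma : 0 < t < 1 -> - 1 < rho + sigma < 1 ->
  (0 <= rho /\ 0 <= sigma) \/ (rho <= 0 /\ sigma <= 0) ->
  0 <= (1 - t `^ rho) * (1 - t `^ sigma)
    <= (1 + t `^ (rho + sigma)) * (1 - t) ^+ 2.
Proof.
move=> t01 rs; have [t0 t1] := andP t01.
have nneg a b : 0 <= a -> 0 <= b -> a + b < 1 ->
    0 <= (1 - t `^ a) * (1 - t `^ b) <= (1 - t) ^+ 2.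
  move=> a0 b0 ab.
  have /andP[ta0 ta1] : 0 <= 1 - t `^ a <= 1 - t.
    by apply: onem_powR_bounds => //; lra.
  have /andP[tb0 tb1] : 0 <= 1 - t `^ b <= 1 - t.
    by apply: onem_powR_bounds => //; lra.
  by rewrite mulr_ge0//= expr2 ler_pM.
have p0 := powR_ge0 t (rho + sigma).
have sq0 : 0 <= (1 - t) ^+ 2 by exact: sqr_ge0.
case=> -[r0 s0].
  have /andP[-> h] : 0 <= (1 - t `^ rho) * (1 - t `^ sigma) <= (1 - t) ^+ 2.
    by apply: nneg => //; lra.
  by rewrite (le_trans h)// ler_peMl// lerDl.
have -> : (1 - t `^ rho) * (1 - t `^ sigma) =
    t `^ (rho + sigma) * ((1 - t `^ (- rho)) * (1 - t `^ (- sigma))).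
  rewrite powRD; last by apply/implyP => _; rewrite gt_eqF.
  rewrite !powRN; have := powR_gt0 rho t0; have := powR_gt0 sigma t0.
  move: (t `^ rho) (t `^ sigma) => x y /lt0r_neq0 y0 /lt0r_neq0 x0.
  by field; rewrite x0 y0.
have /andP[h0 h] :
    0 <= (1 - t `^ (- rho)) * (1 - t `^ (- sigma)) <= (1 - t) ^+ 2.
  by apply: nneg; lra.
rewrite mulr_ge0//= ler_pM// lerDr; lra.
Qed.

Lemma powR_le2 x a : 2^-1 <= x <= 1 -> - 1 <= a -> x `^ a <= 2.
Proof.
move=> /andP[x2 x1] a1.
have x0 : 0 < x by lra.
have x01 : 0 < x <= 1 by rewrite x0.
apply: (le_trans (ger_powR x01 a1)).
rewrite powR_inv1; last exact: ltW.
by rewrite -[leRHS]invrK lef_pV2// posrE; lra.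
Qed.

(* The two factors vanish at t = 1, which compensates the singularity of order
   rho + sigma + 2 < 3 of f there. *)
Lemma integral_onem_powR_mul_lty f c rho sigma : measurable_fun [set: R] f ->
  (forall t, 0 < t < 1 ->
    (0 <= f t <= (c * (1 - t) `^ (- (rho + sigma + 1) - 1))%:E)%E) ->
  0 < c -> - 1 < rho + sigma < 1 ->
  (0 <= rho /\ 0 <= sigma) \/ (rho <= 0 /\ sigma <= 0) ->
  (\int[mu]_(t in `]0%R, 1%R[)
     (((1 - t `^ rho) * (1 - t `^ sigma))%:E * f t) < +oo)%E.
Proof.
move=> mf fb c0 rs rs0; pose b := rho + sigma.
have mu01 : measurable (`]0, 1[%classic : set R) by [].
(* By the two bounds the integrand is at most [c (1 + t^b) (1 - t)^(-b)]. For [t <= 1/2] the last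
   factor is at most 2, which gives the first two terms of [g]; for [t > 1/2] one has [t^b <= 2],
   hence [1 + t^b <= 3] and the third term. All are integrable since [-1 < b < 1]. *)
pose g t := (2 * c + 2 * c * t `^ b + 3 * c * (1 - t) `^ (- b)).
have mpow a : measurable_fun [set: R] (fun t : R => t `^ a).
  exact: measurable_powR.
have mpow1 a : measurable_fun [set: R] (fun t : R => (1 - t) `^ a).
  by apply: (measurableT_comp (mpow a)); exact: measurable_funB.
apply: (@le_lt_trans _ _ (\int[mu]_(t in `]0%R, 1%R[) (g t)%:E)%E).
  apply: ge0_le_integral => //.
  - move=> t /=; rewrite in_itv/= => t01.
    have /andP[h0 _] := onem_powR_mul_bounds t01 rs rs0.
    by have /andP[f0 _] := fb _ t01; rewrite mule_ge0.
  - apply: measurable_funTS; apply: emeasurable_funM => //.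
    apply: measurableT_comp => //.
    by apply: measurable_funM; apply: measurable_funB => //; exact: mpow.
  - apply: measurable_funTS; apply: measurableT_comp => //.
    apply: measurable_funD; last by apply: measurable_funM => //; exact: mpow1.
    by apply: measurable_funD => //; apply: measurable_funM => //; exact: mpow.
  - move=> t /=; rewrite in_itv/= => t01.
    have /andP[h0 h] := onem_powR_mul_bounds t01 rs rs0.
    have /andP[_ ft] := fb _ t01.
    apply: (le_trans (lee_wpmul2l _ ft)); first by rewrite lee_fin.
    rewrite -EFinM lee_fin.
    have [t0 t1] := andP t01.
    have t10 : 0 < 1 - t by rewrite subr_gt0.
    have u0 := powR_ge0 t b; have v0 := powR_ge0 (1 - t) (- b).
    apply: (@le_trans _ _ (c * ((1 + t `^ b) * (1 - t) `^ (- b)))).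
      rewrite mulrCA ler_pM2l//.
      apply: (le_trans (ler_wpM2r (powR_ge0 _ _) h)).
      rewrite -mulrA -powR_mulrn; last exact: ltW.
      rewrite -powRD; last first.
        by apply/implyP => _; rewrite gt_eqF.
      by rewrite (_ : 2%:R + (- (rho + sigma + 1) - 1) = - b)// /b; ring.
    have cu : 0 <= c * t `^ b by rewrite mulr_ge0// ltW.
    have cv : 0 <= c * (1 - t) `^ (- b) by rewrite mulr_ge0// ltW.
    rewrite /g; have [t2|t2] := leP t 2^-1.
      have v2 : (1 - t) `^ (- b) <= 2 by apply: powR_le2; rewrite /b; lra.
      have : 0 <= (c + c * t `^ b) * (2 - (1 - t) `^ (- b)).
        by apply: mulr_ge0; lra.
      by lra.
    have u2 : t `^ b <= 2 by apply: powR_le2; rewrite /b; lra.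
    have : 0 <= c * (1 - t) `^ (- b) * (2 - t `^ b) by apply: mulr_ge0; lra.
    by lra.
under eq_integral do rewrite /g !EFinD.
have nn t : (0 <= (2 * c)%:E + (2 * c * t `^ b)%:E :> \bar R)%E.
  by rewrite -EFinD lee_fin addr_ge0// ?mulr_ge0// ?powR_ge0// ltW.
rewrite ge0_integralD//=; last 3 first.
- apply: measurable_funTS; apply: emeasurable_funD => //.
  by apply: measurableT_comp => //; apply: measurable_funM => //; exact: mpow.
- by move=> t _; rewrite lee_fin !mulr_ge0// ?powR_ge0// ltW.
- by apply: measurable_funTS; apply: measurableT_comp => //;
    apply: measurable_funM => //; exact: mpow1.
apply: lte_add_pinfty.
  rewrite ge0_integralD//=; last 3 first.
  - by move=> t _; rewrite lee_fin mulr_ge0// ltW.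
  - by move=> t _; rewrite lee_fin !mulr_ge0// ?powR_ge0// ltW.
  - by apply: measurable_funTS; apply: measurableT_comp => //;
      apply: measurable_funM => //; exact: mpow.
  apply: lte_add_pinfty.
    rewrite integral_cst//= lebesgue_measure_itv/= lte_fin ltr01 oppr0 adde0.
    by rewrite mule1 ltry.
  under eq_integral do rewrite EFinM.
  rewrite ge0_integralZl//=.
  - apply: lte_mul_pinfty => //; first by rewrite lee_fin mulr_ge0// ltW.
    by apply: integral_powR_unit; case/andP: rs.
  - by apply: measurable_funTS; exact: measurable_EFin_powR.
  - by move=> t _; rewrite lee_fin powR_ge0.
  - by rewrite lee_fin mulr_ge0// ltW.
under eq_integral do rewrite EFinM.
rewrite ge0_integralZl//=.
- apply: lte_mul_pinfty => //; first by rewrite lee_fin mulr_ge0// ltW.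
  by apply: integral_powR_onem_unit; rewrite /b; lra.
- by apply: measurable_funTS; apply: measurableT_comp => //; exact: mpow1.
- by move=> t _; rewrite lee_fin powR_ge0.
- by rewrite lee_fin mulr_ge0// ltW.
Qed.

End kernel_integrals.

(** * The form (a - b) (a^<p-1> - b^<p-1>) and Hölder's inequality *)

Definition pform {R : realType} (p a b : R) : R :=
  (a - b) * (spow a (p - 1) - spow b (p - 1)).

Section pform_theory.
Context {R : realType}.
Implicit Types p a b c : R.

Lemma spow_nneg p a : 1 < p -> 0 <= a -> spow a (p - 1) = a `^ (p - 1).
Proof.
move=> p1; rewrite /spow le_eqVlt => /predU1P[<-|a0].
  by rewrite normr0 sgr0 mulr0 powR0// gt_eqF// subr_gt0.
by rewrite gtr0_norm// gtr0_sg// mulr1.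
Qed.

Lemma norm_spow p a : 1 < p -> `|spow a (p - 1)| = `|a| `^ (p - 1).
Proof.
move=> p1; have [->|a0] := eqVneq a 0.
  by rewrite spow_nneg// normr0 ger0_norm// powR_ge0.
by rewrite /spow normrM normr_sg a0 mulr1 ger0_norm// powR_ge0.
Qed.

Lemma mulr_spow p a : 1 < p -> a * spow a (p - 1) = `|a| `^ p.
Proof.
move=> p1; rewrite /spow mulrCA (mulrC a) -normrEsg mulrC mulr_powRB1//.
exact: lt_trans p1.
Qed.

Lemma pform_nneg p a b : 1 < p -> 0 <= a -> 0 <= b ->
  pform p a b = a `^ p + b `^ p - (a * b `^ (p - 1) + b * a `^ (p - 1)).
Proof.
move=> p1 a0 b0; rewrite /pform !spow_nneg// mulrBl !mulrBr.
have p0 : 0 < p by exact: lt_trans p1.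
by rewrite !mulr_powRB1//; ring.
Qed.

(** Absolute values leave the pure terms [|a|^p] and [|b|^p] unchanged and can only increase the
    mixed products, which enter with a minus sign. *)
Lemma pform_norm p a b : 1 < p -> pform p `|a| `|b| <= pform p a b.
Proof.
move=> p1; rewrite pform_nneg// /pform mulrBl !mulrBr !mulr_spow//.
rewrite -!norm_spow//.
have h1 : a * spow b (p - 1) <= `|a| * `|spow b (p - 1)|.
  by rewrite -normrM ler_norm.
have h2 : b * spow a (p - 1) <= `|b| * `|spow a (p - 1)|.
  by rewrite -normrM ler_norm.
lra.
Qed.

Lemma pform_ge0 p a b : 1 < p -> 0 <= pform p a b.
Proof.
move=> p1; apply: le_trans (pform_norm _ _ p1).
rewrite /pform !spow_nneg//; have p0 : 0 <= p - 1 by lra.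
have [ab|/ltW ba] := leP `|a| `|b|.
  by rewrite mulr_le0// subr_le0// ge0_ler_powR// nnegrE.
by rewrite mulr_ge0// subr_ge0// ge0_ler_powR// nnegrE.
Qed.

Lemma pform_scale p a b c : 1 < p -> 0 <= a -> 0 <= b -> 0 <= c ->
  pform p (c * a) (c * b) = c `^ p * pform p a b.
Proof.
move=> p1 a0 b0 c0.
rewrite !pform_nneg ?mulr_ge0// !powRM// -(mulr_powRB1 c0 (lt_trans ltr01 p1)).
by ring.
Qed.

Lemma measurable_pform p d (T : measurableType d) (f g : T -> R) :
  measurable_fun [set: T] f -> measurable_fun [set: T] g ->
  measurable_fun [set: T] (fun x => pform p (f x) (g x)).
Proof.
move=> mf mg.
have msg : measurable_fun [set: R] (Num.sg : R -> R).
  apply: nondecreasing_measurable => // x y xy.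
  case: (sgrP x) => [x0|x0|x0]; case: (sgrP y) => [y0|y0|y0] //; lra.
have mspow : measurable_fun [set: R] (fun x : R => spow x (p - 1)).
  apply: measurable_funM => //.
  by apply: (measurableT_comp (measurable_powR _)); exact: normr_measurable.
by apply: measurable_funM; apply: measurable_funB => //;
  apply: (measurableT_comp mspow).
Qed.

End pform_theory.

Section hoelder_pform.
Context d (T : measurableType d) {R : realType}.
Variable mu : {measure set T -> \bar R}.
Implicit Types (p a b : R) (f g : T -> R).

Lemma conj_exp_gt1 p : 1 < p -> 1 < conj_exp p.
Proof. by move=> p1; rewrite /conj_exp ltr_pdivlMr; lra. Qed.

Lemma conj_expV p : 1 < p -> p^-1 + (conj_exp p)^-1 = 1.
Proof.
move=> p1; rewrite /conj_exp invf_div; have p0 : p != 0 by rewrite gt_eqF; lra.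
by field.
Qed.

(** Hölder's inequality with exponents [p] and [q]: since [(p - 1) q = p], the [q]-norm of [g^(p-1)]
    is [b^(p-1)]. *)
Lemma integral_mul_powR_le p f g a b : 1 < p ->
  measurable_fun [set: T] f -> measurable_fun [set: T] g ->
  (forall x, 0 <= f x) -> (forall x, 0 <= g x) -> 0 <= a -> 0 <= b ->
  (\int[mu]_x (f x `^ p)%:E = (a `^ p)%:E)%E ->
  (\int[mu]_x (g x `^ p)%:E = (b `^ p)%:E)%E ->
  (\int[mu]_x (f x * g x `^ (p - 1))%:E <= (a * b `^ (p - 1))%:E)%E.
Proof.
move=> p1 mf mg f0 g0 a0 b0 fa gb; pose q := conj_exp p.
have p0 : 0 < p by lra.
have pn0 : p != 0 by rewrite gt_eqF.
have p1n0 : p - 1 != 0 by rewrite gt_eqF// subr_gt0.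
have q0 : 0 < q by apply: lt_trans (conj_exp_gt1 p1).
have mh : measurable_fun [set: T] (fun x => g x `^ (p - 1)).
  exact: (measurableT_comp (measurable_powR _)).
have := hoelder mu mf mh p0 q0 (conj_expV p1).
rewrite Lnorm1 unlock /=.
rewrite (_ : (\int[mu]_x `|(f x * g x `^ (p - 1))%:E| =
  \int[mu]_x (f x * g x `^ (p - 1))%:E)%E); last first.
  by apply: eq_integral => x _; rewrite gee0_abs// lee_fin mulr_ge0// powR_ge0.
rewrite (_ : (\int[mu]_x (`|f x| `^ p)%:E = (a `^ p)%:E)%E); last first.
  by rewrite -fa; apply: eq_integral => x _; rewrite ger0_norm.
rewrite (_ : (\int[mu]_x (`|g x `^ (p - 1)| `^ q)%:E = (b `^ p)%:E)%E);
  last first.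
  rewrite -gb; apply: eq_integral => x _; rewrite ger0_norm ?powR_ge0//.
  by rewrite -powRrM /q /conj_exp mulrC divfK.
rewrite !poweR_EFin -EFinM -!powRrM divff// powRr1//.
by rewrite (_ : p / q = p - 1)// /q /conj_exp invf_div mulrC divfK.
Qed.

(** Of the four products in the form, two integrate exactly to [a^p] and [b^p]. The other two are
    subtracted and are bounded above by Hölder's inequality. *)
Lemma hoelder_pform p f g a b : 1 < p ->
  measurable_fun [set: T] f -> measurable_fun [set: T] g ->
  (forall x, 0 <= f x) -> (forall x, 0 <= g x) -> 0 <= a -> 0 <= b ->
  (\int[mu]_x (f x `^ p)%:E = (a `^ p)%:E)%E ->
  (\int[mu]_x (g x `^ p)%:E = (b `^ p)%:E)%E ->
  ((pform p a b)%:E <= \int[mu]_x (pform p (f x) (g x))%:E)%E.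
Proof.
move=> p1 mf mg f0 g0 a0 b0 fa gb.
have mpow h c : measurable_fun [set: T] h ->
    measurable_fun [set: T] (fun x => h x `^ c).
  by move=> mh; exact: (measurableT_comp (measurable_powR _)).
(* Adding the nonnegative mixed terms N to the form turns it into f^p + g^p,
   so that no integrability of the form itself is needed. *)
pose N x := f x * g x `^ (p - 1) + g x * f x `^ (p - 1).
have N0 x : 0 <= N x by rewrite addr_ge0// mulr_ge0// powR_ge0.
have mN : measurable_fun [set: T] N.
  by apply: measurable_funD; apply: measurable_funM => //; exact: mpow.
have intN : (\int[mu]_x (N x)%:E
    <= (a * b `^ (p - 1) + b * a `^ (p - 1))%:E)%E.
  under eq_integral do rewrite EFinD.
  rewrite ge0_integralD//=.
  - by rewrite EFinD; apply: leeD; exact: integral_mul_powR_le.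
  - by move=> x _; rewrite lee_fin mulr_ge0// powR_ge0.
  - by apply: measurableT_comp => //; apply: measurable_funM => //; exact: mpow.
  - by move=> x _; rewrite lee_fin mulr_ge0// powR_ge0.
  - by apply: measurableT_comp => //; apply: measurable_funM => //; exact: mpow.
rewrite pform_nneg// EFinB leeBlDr//.
apply: (@le_trans _ _
    (\int[mu]_x (pform p (f x) (g x))%:E + \int[mu]_x (N x)%:E)%E); last first.
  exact: leeD2l.
rewrite -ge0_integralD//=; last 4 first.
- by move=> x _; rewrite lee_fin pform_ge0.
- by apply: measurableT_comp => //; exact: measurable_pform.
- by move=> x _; rewrite lee_fin.
- exact: measurableT_comp.
rewrite EFinD -fa -gb -ge0_integralD//=; last 4 first.
- by move=> x _; rewrite lee_fin powR_ge0.
- by apply: measurableT_comp => //; exact: mpow.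
- by move=> x _; rewrite lee_fin powR_ge0.
- by apply: measurableT_comp => //; exact: mpow.
apply/eqW/eq_integral => x _.
by rewrite -!EFinD pform_nneg// subrK.
Qed.

End hoelder_pform.

(** * Lower bound for a homogeneous kernel on a quadrant *)

Section quadrant.
Context {R : realType}.
Local Notation mu := (@lebesgue_measure R).
Implicit Types (kappa : R -> R -> \bar R) (v w : R -> R) (alpha p a b t : R).

(** The form is homogeneous of degree [p], so the weight can be moved into the functions as
    [x^(-alpha/p)]. The dilation by [t] then multiplies the norm of [w] by [t^((alpha-1)/p)]. *)
Lemma weighted_pform p alpha v w t a b : 1 < p -> 0 < t ->
  measurable_fun [set: R] v -> measurable_fun [set: R] w ->
  0 <= a -> 0 <= b ->
  (\int[mu]_(x in `]0%R, +oo[) (`|v x| `^ p * x `^ (- alpha))%:E =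
    (a `^ p)%:E)%E ->
  (\int[mu]_(x in `]0%R, +oo[) (`|w x| `^ p * x `^ (- alpha))%:E =
    (b `^ p)%:E)%E ->
  ((pform p a (t `^ ((alpha - 1) / p) * b))%:E <=
   \int[mu]_(x in `]0%R, +oo[)
     (x `^ (- alpha) * pform p (v x) (w (x * t)%R))%:E)%E.
Proof.
move=> p1 t0 mv mw a0 b0 va wb.
have p0 : p != 0 by rewrite gt_eqF//; lra.
have mpow c : measurable_fun [set: R] (fun x : R => x `^ c).
  exact: measurable_powR.
have mwt : measurable_fun [set: R] (fun x => w (x * t)).
  by apply: (measurableT_comp mw); exact: measurable_funM.
(* Extension by zero turns the problem on the half-line into one on the whole line, and the absolute
   value supplies the nonnegativity that [hoelder_pform] asks for. *)
pose lift (h : R -> R) x := if 0 < x then `|h x| * x `^ (- alpha / p) else 0.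
have mlift h : measurable_fun [set: R] h -> measurable_fun [set: R] (lift h).
  move=> mh; apply: measurable_fun_ifT => //; first exact: measurable_fun_ltr.
  by apply: measurable_funM; [exact: measurableT_comp|exact: mpow].
have lift0 h x : 0 <= lift h x.
  by rewrite /lift; case: ifP => // _; rewrite mulr_ge0// powR_ge0.
have liftE h x : 0 < x -> lift h x = x `^ (- alpha / p) * `|h x|.
  by move=> x0; rewrite /lift x0 mulrC.
have lift_le0 h x : ~~ (0 < x) -> lift h x = 0.
  by move=> x0; rewrite /lift (negbTE x0).
have powp x : (x `^ (- alpha / p)) `^ p = x `^ (- alpha).
  by rewrite -powRrM divfK.
have int_lift h : (\int[mu]_x (lift h x `^ p)%:E =
    \int[mu]_(x in `]0%R, +oo[) (`|h x| `^ p * x `^ (- alpha))%:E)%E.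
  rewrite [RHS]integral_mkcond; apply: eq_integral => x _.
  rewrite /patch mem_setE in_itv/= andbT; case: ifPn => x0.
    by rewrite liftE// powRM ?powR_ge0// powp mulrC.
  by rewrite lift_le0// powR0.
rewrite [leRHS]integral_mkcond.
apply: (@le_trans _ _ (\int[mu]_x
    (pform p (lift v x) (lift (fun x => w (x * t)) x))%:E)%E).
  apply: hoelder_pform => //; try exact: mlift.
  - by rewrite mulr_ge0// powR_ge0.
  - by rewrite int_lift.
  rewrite int_lift.
  pose H (y : R) : \bar R := (`|w y| `^ p * y `^ (- alpha))%:E.
  have mH : measurable_fun [set: R] H.
    apply: measurableT_comp => //; apply: measurable_funM => //.
    by apply: (measurableT_comp (mpow p)); exact: measurableT_comp.
  have H0 y : (0 <= H y)%E by rewrite lee_fin mulr_ge0// powR_ge0.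
  (* The weight contributes [t^alpha] and the Lebesgue measure [t^-1]; their product is the [p]-th
     power of [t^((alpha-1)/p)]. *)
  transitivity (\int[mu]_(x in `]0%R, +oo[) ((t `^ alpha)%:E * H (t * x)%R))%E.
    apply: eq_integral => x; rewrite mem_setE in_itv/= andbT => x0.
    rewrite /H -EFinM (mulrC t) powRM ?ltW//; congr EFin.
    have <- : t `^ alpha * t `^ (- alpha) * (`|w (x * t)| `^ p * x `^ (- alpha))
        = `|w (x * t)| `^ p * x `^ (- alpha).
      by rewrite powRN divff ?mul1r// gt_eqF// powR_gt0.
    by ring.
  rewrite ge0_integralZl//=; last 2 first.
  - by apply: measurable_funTS; apply: (measurableT_comp mH);
      exact: measurable_funM.
  - by rewrite lee_fin powR_ge0.
  rewrite ge0_integral_pos_scale// wb -!EFinM; congr EFin.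
  rewrite mulrA powRM ?powR_ge0// -powRrM divfK//; congr (_ * _).
  by rewrite -powR_inv1 ?ltW// -powRD//; apply/implyP => _; rewrite gt_eqF.
have mlv := mlift _ mv; have mlw := mlift _ mwt.
apply: ge0_le_integral => //.
- by move=> x _; rewrite lee_fin pform_ge0.
- by apply: measurableT_comp => //; exact: measurable_pform.
- apply/(measurable_restrictT _ _).1 => //; apply: measurable_funTS.
  apply: measurableT_comp => //; apply: measurable_funM => //.
  exact: measurable_pform.
- move=> x _; rewrite /patch mem_setE in_itv/= andbT; case: ifPn => x0.
    rewrite !liftE// lee_fin pform_scale ?powR_ge0// powp.
    by rewrite ler_wpM2l ?powR_ge0// pform_norm.
  by rewrite !lift_le0// /pform subrr mul0r.
Qed.

(** By homogeneity [x kappa(x, x t) = x^(-alpha) kappa(1, t)], so for each [t] the inner integral is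
    that of [weighted_pform]. Keeping [v] and [w] distinct lets the same bound serve the mixed
    quadrants. *)
Lemma quadrant_bound p alpha kappa v w a b : 1 < p ->
  mfun2 kappa -> (forall x y, (0 <= kappa x y)%E) ->
  (forall x y r : R, 0 < r ->
    kappa (r * x)%R (r * y)%R = ((r `^ (- alpha - 1))%:E * kappa x y)%E) ->
  measurable_fun [set: R] v -> measurable_fun [set: R] w ->
  0 <= a -> 0 <= b ->
  (\int[mu]_(x in `]0%R, +oo[) (`|v x| `^ p * x `^ (- alpha))%:E =
    (a `^ p)%:E)%E ->
  (\int[mu]_(x in `]0%R, +oo[) (`|w x| `^ p * x `^ (- alpha))%:E =
    (b `^ p)%:E)%E ->
  (\int[mu]_(t in `]0%R, +oo[)
     ((pform p a (t `^ ((alpha - 1) / p) * b))%:E * kappa 1%R t) <=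
   \int[mu]_(x in `]0%R, +oo[) \int[mu]_(y in `]0%R, +oo[)
     ((pform p (v x) (w y))%:E * kappa x y))%E.
Proof.
move=> p1 mk k0 khom mv mw a0 b0 va wb.
pose F x y := ((pform p (v x) (w y))%:E * kappa x y)%E.
pose G t x := ((x `^ 1)%:E * F x (x `^ 1 * t `^ 1)%R)%E.
have F0 x y : (0 <= F x y)%E by rewrite mule_ge0// lee_fin pform_ge0.
have mF : mfun2 F.
  apply: emeasurable_funM => //; apply: measurableT_comp => //.
  apply: measurable_pform.
    exact: (measurableT_comp mv measurable_fst).
  exact: (measurableT_comp mw measurable_snd).
have G0 t x : (0 <= G t x)%E by rewrite mule_ge0// lee_fin powR_ge0.
have mG : mfun2 G.
  pose Gs x t := G t x.
  have mGs : mfun2 Gs by exact: mfun2_powR_mul.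
  exact: (measurableT_comp mGs
    (@measurable_swap _ _ (measurableTypeR R) (measurableTypeR R))).
rewrite (tonelli_polar mF); last by move=> *; exact: F0.
have kappa1 : measurable_fun [set: R] (kappa 1).
  exact: (measurableT_comp mk (pair1_measurable (1 : measurableTypeR R))).
rewrite [leRHS](_ : _ =
    \int[mu]_(t in `]0%R, +oo[) \int[mu]_(x in `]0%R, +oo[) G t x)%E;
  last first.
  apply: eq_integral => t; rewrite mem_setE in_itv/= andbT => t0.
  apply: eq_integral => x; rewrite mem_setE in_itv/= andbT => x0.
  by rewrite /G !powRr1// ltW.
apply: ge0_le_integral => //.
- by move=> t _; rewrite mule_ge0// lee_fin pform_ge0.
- apply: measurable_funTS; apply: emeasurable_funM => //.
  apply: measurableT_comp => //; apply: measurable_pform => //.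
  by apply: measurable_funM => //; exact: measurable_powR.
- by apply: measurable_int_pos => // *; exact: G0.
move=> t /=; rewrite in_itv/= andbT => t0.
have mxt : measurable_fun [set: R]
    (fun x => (x `^ (- alpha) * pform p (v x) (w (x * t)))%:E).
  apply: measurableT_comp => //; apply: measurable_funM.
    exact: measurable_powR.
  apply: measurable_pform => //.
  by apply: (measurableT_comp mw); exact: measurable_funM.
(* The value [kappa 1 t] may be [+oo], so it is pulled out as a nonnegative extended scalar. *)
rewrite [leRHS](_ : _ = kappa 1%R t * \int[mu]_(x in `]0%R, +oo[)
    (x `^ (- alpha) * pform p (v x) (w (x * t)%R))%:E)%E; last first.
  rewrite -ge0_integralZl//=.
  - apply: eq_integral => x; rewrite mem_setE in_itv/= andbT => x0.
    rewrite /G /F !powRr1 ?ltW// -[X in kappa X]mulr1 khom//.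
    rewrite !muleA [RHS]muleC -!EFinM; congr (_%:E * _)%E.
    rewrite powRD; last by apply/implyP => _; rewrite gt_eqF.
    rewrite powR_inv1 ?ltW//; have xn0 : x != 0 by rewrite gt_eqF.
    by field.
  - exact: measurable_funTS.
  - by move=> x _; rewrite lee_fin mulr_ge0 ?powR_ge0// pform_ge0.
rewrite muleC; apply: lee_wpmul2l => //.
exact: weighted_pform.
Qed.

End quadrant.

(** * Symmetric homogeneous kernels *)

Section homogeneous_kernels.
Context {R : realType}.
Local Notation mu := (@lebesgue_measure R).
Implicit Types (k kappa F : R -> R -> \bar R) (f : R -> \bar R)
  (alpha p rho sigma a b t : R).

Lemma integral_quadrants F : mfun2 F -> (forall x y, (0 <= F x y)%E) ->
  (\int[mu]_x \int[mu]_y F x y =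
   (\int[mu]_(x in `]0%R, +oo[) \int[mu]_(y in `]0%R, +oo[) F x y +
    \int[mu]_(x in `]0%R, +oo[) \int[mu]_(y in `]0%R, +oo[) F x (- y)%R) +
   (\int[mu]_(x in `]0%R, +oo[) \int[mu]_(y in `]0%R, +oo[) F (- x)%R y +
    \int[mu]_(x in `]0%R, +oo[) \int[mu]_(y in `]0%R, +oo[)
      F (- x)%R (- y)%R))%E.
Proof.
move=> mF F0.
have msgn (s1 s2 : R -> R) : measurable_fun [set: R] s1 ->
    measurable_fun [set: R] s2 -> mfun2 (fun x y => F (s1 x) (s2 y)).
  move=> ms1 ms2; apply: (@measurableT_comp _ _ _ _ _ _ (fun z => F z.1 z.2) _
    (fun z : measurableTypeR R * measurableTypeR R =>
     (s1 z.1, s2 z.2) : measurableTypeR R * measurableTypeR R)) => //.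
  apply/measurable_fun_pairP; split => /=.
    exact: (measurableT_comp ms1 measurable_fst).
  exact: (measurableT_comp ms2 measurable_snd).
have mN : measurable_fun [set: R] (-%R : R -> R) by exact: oppr_measurable.
have mI : measurable_fun [set: R] (@id R) by exact: measurable_id.
have mFx x : measurable_fun [set: R] (F x).
  exact: (measurableT_comp mF (pair1_measurable (x : measurableTypeR R))).
have half (s : R -> R) : measurable_fun [set: R] s ->
  (\int[mu]_(x in `]0%R, +oo[) \int[mu]_y F (s x) y =
   \int[mu]_(x in `]0%R, +oo[) \int[mu]_(y in `]0%R, +oo[) F (s x) y +
   \int[mu]_(x in `]0%R, +oo[) \int[mu]_(y in `]0%R, +oo[) F (s x) (- y)%R)%E.
  move=> ms; rewrite -ge0_integralD//=.
  - by apply: eq_integral => x _; rewrite ge0_integral_pos_neg.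
  - by move=> x _; exact: integral_ge0.
  - by apply: (measurable_int_pos (msgn s id ms mI)).
  - by move=> x _; exact: integral_ge0.
  - by apply: (measurable_int_pos (msgn s -%R ms mN)).
have mint : measurable_fun [set: R] (fun x => \int[mu]_y F x y)%E.
  have := @measurable_fun_fubini_tonelli_F _ _ _ _ _ mu _ mF.
  by apply => z; exact: F0.
rewrite (ge0_integral_pos_neg mint); last by move=> x; exact: integral_ge0.
by rewrite (half id)// (half -%R).
Qed.

Lemma homogeneous_inv kappa alpha t : 0 < t ->
  (forall x y r : R, 0 < r ->
    kappa (r * x)%R (r * y)%R = ((r `^ (- alpha - 1))%:E * kappa x y)%E) ->
  forall x y : R,
    kappa x (t `^ (- 1) * y)%R = ((t `^ (alpha + 1))%:E * kappa (t * x)%R y)%E.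
Proof.
move=> t0 khom x y.
have {1}-> : x = t `^ (- 1) * (t * x).
  by rewrite powR_inv1 ?ltW// mulrA mulVf ?mul1r// gt_eqF.
rewrite khom ?powR_gt0// -powRrM; congr ((_ `^ _)%:E * _)%E.
by ring.
Qed.

(** Under [t -> 1/t] the two factors yield [t^(-(alpha-1))], the kernel [t^(alpha+1)] and the
    Jacobian [t^(-2)]. These cancel, so the integrand is invariant and [(0, 1)] and [(1, +oo)]
    contribute equally. *)
Lemma integral_kernel_fold kappa alpha rho sigma : rho + sigma = alpha - 1 ->
  mfun2 kappa -> (forall x y, (0 <= kappa x y)%E) ->
  (forall x y, kappa x y = kappa y x) ->
  (forall x y r : R, 0 < r ->
    kappa (r * x)%R (r * y)%R = ((r `^ (- alpha - 1))%:E * kappa x y)%E) ->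
  (forall t, 0 < t -> 0 <= (1 - t `^ rho) * (1 - t `^ sigma)) ->
  (\int[mu]_(t in `]0%R, +oo[)
     (((1 - t `^ rho) * (1 - t `^ sigma))%:E * kappa 1%R t) =
   2%:E * \int[mu]_(t in `]0%R, 1%R[)
     (((1 - t `^ rho) * (1 - t `^ sigma))%:E * kappa 1%R t))%E.
Proof.
move=> rs mk k0 ksym khom h0.
pose g t := (((1 - t `^ rho) * (1 - t `^ sigma))%:E * kappa 1%R t)%E.
have mk1 : measurable_fun [set: R] (kappa 1).
  exact: (measurableT_comp mk (pair1_measurable (1 : measurableTypeR R))).
have mg : measurable_fun [set: R] g.
  apply: emeasurable_funM => //; apply: measurableT_comp => //.
  by apply: measurable_funM; apply: measurable_funB => //;
    exact: measurable_powR.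
have g0 t : 0 < t -> (0 <= g t)%E.
  by move=> t0; rewrite mule_ge0// lee_fin h0.
have ginv t : 0 < t -> ((t `^ (- 2))%:E * g (t `^ (- 1))%R = g t)%E.
  move=> t0; rewrite /g -[X in kappa _ X]mulr1 (homogeneous_inv t0 khom) mulr1.
  rewrite (ksym t) !muleA -!EFinM; congr (_%:E * _)%E.
  have <- : t `^ rho * t `^ sigma * t `^ 2 = t `^ (alpha + 1).
    rewrite -!powRD; try by apply/implyP => _; rewrite gt_eqF.
    by congr powR; lra.
  rewrite -!powRrM !mulN1r !powRN.
  have := powR_gt0 rho t0; have := powR_gt0 sigma t0; have := powR_gt0 2 t0.
  move: (t `^ rho) (t `^ sigma) (t `^ 2).
  move=> x y z /lt0r_neq0 z0 /lt0r_neq0 y0 /lt0r_neq0 x0.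
  by field; rewrite x0 y0 z0.
rewrite -/g.
have tail : (\int[mu]_(t in `]0%R, 1%R[) g t =
    \int[mu]_(t in `[1%R, +oo[) g t)%E.
  rewrite -integral_itv_obnd_cbnd; last exact: measurable_funTS.
  rewrite -integral_pos_if_lt1 ge0_integral_inv; last 2 first.
  - exact: measurable_if_lt1.
  - by move=> x x0; case: ifP => // _; exact: g0.
  rewrite [LHS]integral_mkcond [RHS]integral_mkcond.
  apply: eq_integral => t _; rewrite /patch !mem_setE !in_itv/= !andbT.
  have [t0|t0] := ltP 0 t; last by rewrite ltNge (le_trans t0).
  have -> : (t `^ (- 1) < 1) = (1 < t).
    by rewrite powR_inv1 ?ltW// invf_lt1.
  by case: ifP => // _; [rewrite ginv|rewrite mule0].
have -> : `]0, +oo[%classic = `]0, 1[ `|` `[1, +oo[ :> set R.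
  by rewrite -itv_bndbnd_setU// bnd_simp.
rewrite ge0_integral_setU//=.
- rewrite -tail -[X in (X%:E * _)%E]/(1 + 1) EFinD ge0_muleDl// mul1e//.
- exact: measurable_funTS.
- by move=> t /= []; rewrite in_itv/= => /andP[t0 t1]; apply: g0 => //;
    exact: lt_le_trans t0.
- apply/disj_setPLR => t /=; rewrite !in_itv/= andbT => /andP[_ t1].
  by apply/negP; rewrite -ltNge.
Qed.

(** The exchange [a -> alpha - 1 - a] swaps [rho] with [sigma] and 0 with [alpha - 1]. Hence the
    cross integrals in [C_minus] are among those of [k(1, -t)]. *)
Lemma integral_kernel_flip k alpha a : mfun2 k ->
  (forall x y, (0 <= k x y)%E) ->
  (forall x y, k x y = k y x) ->
  (forall x y r : R, 0 < r ->
    k (r * x)%R (r * y)%R = ((r `^ (- alpha - 1))%:E * k x y)%E) ->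
  (\int[mu]_(t in `]0%R, +oo[) ((t `^ a)%:E * k (- 1)%R t) =
   \int[mu]_(t in `]0%R, +oo[) ((t `^ (alpha - 1 - a))%:E * k 1%R (- t)%R))%E.
Proof.
move=> mk k0 ksym khom; rewrite ge0_integral_inv.
- apply: eq_integral => t; rewrite mem_setE in_itv/= andbT => t0.
  rewrite -[X in k _ X]mulr1 (homogeneous_inv t0 khom) mulrN1 ksym.
  rewrite !muleA -!EFinM; congr (_%:E * _)%E.
  rewrite -powRrM -!powRD; try by apply/implyP => _; rewrite gt_eqF.
  by congr powR; ring.
- apply: emeasurable_funM; first exact: measurable_EFin_powR.
  exact: (measurableT_comp mk (pair1_measurable (- 1 : measurableTypeR R))).
- by move=> x _; rewrite mule_ge0// lee_fin powR_ge0.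
Qed.

End homogeneous_kernels.

(** * The four quadrants *)

Section assembly.
Context {R : realType}.
Local Notation mu := (@lebesgue_measure R).
Variables (alpha p : R) (k : R -> R -> \bar R).
Hypothesis halpha : 0 < alpha < 2.
Hypothesis hp : 1 < p.
Hypothesis hk : kernel_class alpha k.

Implicit Types (a b c s t : R) (u v w : R -> R).

Let q := conj_exp p.
Let rho := (alpha - 1) / p.
Let sigma := (alpha - 1) / q.
Let h t := (1 - t `^ rho) * (1 - t `^ sigma).

Lemma exponents_sum : rho + sigma = alpha - 1.
Proof. by rewrite /rho /sigma -mulrDr conj_expV ?mulr1. Qed.

Lemma exponents_sign : (0 <= rho /\ 0 <= sigma) \/ (rho <= 0 /\ sigma <= 0).
Proof.
have p0 : 0 < p^-1 by rewrite invr_gt0 (lt_trans ltr01 hp).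
have q0 : 0 < q^-1 by rewrite invr_gt0 (lt_trans ltr01 (conj_exp_gt1 hp)).
rewrite /rho /sigma; have [a1|a1] := leP 1 alpha; [left|right].
  by split; apply: mulr_ge0; rewrite ?subr_ge0// ltW.
by split; apply: mulr_le0_ge0; rewrite ?subr_le0 ltW.
Qed.

(** As the exponents have the same sign, [1 - t^rho] and [1 - t^sigma] change sign together at
    [t = 1]. *)
Lemma factor_ge0 t : 0 < t -> 0 <= h t.
Proof.
move=> t0.
have pos a : 0 <= a -> (t <= 1 -> t `^ a <= 1) /\ (1 <= t -> 1 <= t `^ a).
  move=> a0; split => t1; rewrite -(powRr0 t).
    by apply: ger_powR => //; rewrite t0.
  exact: ler_powR.
have neg a : a <= 0 -> (t <= 1 -> 1 <= t `^ a) /\ (1 <= t -> t `^ a <= 1).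
  move=> a0; split => t1; rewrite -(powRr0 t).
    by apply: ger_powR => //; rewrite t0.
  exact: ler_powR.
rewrite /h; have [t1|/ltW t1] := leP t 1.
  case: exponents_sign => -[/[swap] s0 r0].
    have [/(_ t1) h1 _] := pos _ r0; have [/(_ t1) h2 _] := pos _ s0.
    by rewrite mulr_ge0// subr_ge0.
  have [/(_ t1) h1 _] := neg _ r0; have [/(_ t1) h2 _] := neg _ s0.
  by rewrite mulr_le0// subr_le0.
case: exponents_sign => -[/[swap] s0 r0].
  have [_ /(_ t1) h1] := pos _ r0; have [_ /(_ t1) h2] := pos _ s0.
  by rewrite mulr_le0// subr_le0.
have [_ /(_ t1) h1] := neg _ r0; have [_ /(_ t1) h2] := neg _ s0.
by rewrite mulr_ge0// subr_ge0.
Qed.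

(** The exponents come from [rho p = alpha - 1] and [rho (p - 1) = sigma]. This is what pairs
    [a b^(p-1)] with [l_q] and [b a^(p-1)] with [l_p]. *)
Lemma pform_powR a b t : 0 <= a -> 0 <= b -> 0 < t ->
  pform p a (t `^ rho * b) = a `^ p + t `^ (alpha - 1) * b `^ p
    - (a * b `^ (p - 1) * t `^ sigma + b * a `^ (p - 1) * t `^ rho).
Proof.
move=> a0 b0 t0; have pn0 : p != 0 by rewrite gt_eqF// (lt_trans ltr01 hp).
rewrite pform_nneg ?mulr_ge0 ?powR_ge0// !powRM ?powR_ge0// -!powRrM.
have -> : rho * p = alpha - 1 by rewrite /rho divfK.
have -> : rho * (p - 1) = sigma.
  by rewrite /sigma /q /conj_exp /rho invf_div; field.
by ring.
Qed.

Lemma pform_diag a t : 0 <= a -> 0 < t ->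
  pform p a (t `^ rho * a) = a `^ p * h t.
Proof.
move=> a0 t0; rewrite pform_powR// /h -exponents_sum (@powRD _ t rho);
  last first.
  by apply/implyP => _; rewrite gt_eqF.
by rewrite (mulr_powRB1 a0 (lt_trans ltr01 hp)); ring.
Qed.

Lemma measurable_kernel_section x s :
  measurable_fun [set: R] (fun t => k x (s * t)).
Proof.
have [mk _ _ _ _] := hk.
have mkx : measurable_fun [set: R] (k x).
  exact: (measurableT_comp mk (pair1_measurable (x : measurableTypeR R))).
by apply: (measurableT_comp mkx); exact: measurable_funM.
Qed.

(** The points 1 and [-t] are at distance [1 + t], so the kernel is bounded near [t = 0] and decays
    like [t^(-alpha-1)]. *)
Lemma cross_integral_fin a : - 1 < a < alpha ->
  (\int[mu]_(t in `]0%R, +oo[) ((t `^ a)%:E * k 1%R (- t)%R))%E \is a fin_num.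
Proof.
move=> aal; have [mk k0 ksym khom [c c0 kb]] := hk.
rewrite ge0_fin_numE; last first.
  by apply: integral_ge0 => t _; rewrite mule_ge0// lee_fin powR_ge0.
apply: (@integral_powR_decay_lty _ _ c alpha) => //.
- under eq_fun do rewrite -mulN1r; exact: measurable_kernel_section.
- move=> t t0; rewrite k0/= (le_trans (kb _ _ _))//; last first.
    by rewrite opprK gtr0_norm// addr_gt0.
  by rewrite gt_eqF//; lra.
- by case/andP: halpha.
Qed.

(** For [s] equal to 1 or -1 the points [s] and [s t] are distinct and at distance [1 - t], so both
    half-lines obey the same kernel bound. *)
Lemma radial_integral_fin (s : R) : `|s| = 1 ->
  (\int[mu]_(t in `]0%R, 1%R[) ((h t)%:E * k s (s * t)%R))%E \is a fin_num.
Proof.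
move=> s1; have [mk k0 ksym khom [c c0 kb]] := hk.
rewrite ge0_fin_numE; last first.
  apply: integral_ge0 => t /=; rewrite in_itv/= => /andP[t0 _].
  by rewrite mule_ge0// lee_fin factor_ge0.
apply: (@integral_onem_powR_mul_lty _ _ c) => //.
- exact: measurable_kernel_section.
- move=> t /andP[t0 t1]; rewrite k0/= exponents_sum.
  have st : s - s * t = s * (1 - t) by ring.
  have s0 : s != 0 by rewrite -normr_eq0 s1 oner_eq0.
  rewrite (le_trans (kb _ _ _))//; last first.
    by rewrite st normrM s1 mul1r gtr0_norm ?subr_gt0// lee_fin subrK.
  by rewrite -subr_eq0 st mulf_neq0// gt_eqF// subr_gt0.
- by rewrite exponents_sum; move: halpha => ?; lra.
- exact: exponents_sign.
Qed.

Lemma diag_bound s v a : `|s| = 1 -> measurable_fun [set: R] v -> 0 <= a ->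
  (\int[mu]_(x in `]0%R, +oo[) (`|v x| `^ p * x `^ (- alpha))%:E =
    (a `^ p)%:E)%E ->
  ((a `^ p)%:E * (2%:E * \int[mu]_(t in `]0%R, 1%R[) ((h t)%:E * k s (s * t)%R))
   <= \int[mu]_(x in `]0%R, +oo[) \int[mu]_(y in `]0%R, +oo[)
     ((pform p (v x) (v y))%:E * k (s * x)%R (s * y)%R))%E.
Proof.
move=> s1 mv a0 va; have [mk k0 ksym khom _] := hk.
pose kappa x y := k (s * x) (s * y).
have kappaE t : kappa 1 t = k s (s * t) by rewrite /kappa mulr1.
have mkappa : measurable_fun [set: measurableTypeR R * measurableTypeR R]
    (fun z => kappa z.1 z.2).
  apply: (@measurableT_comp _ _ _ _ _ _ (fun z => k z.1 z.2) _
    (fun z : measurableTypeR R * measurableTypeR R =>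
     (s * z.1, s * z.2) : measurableTypeR R * measurableTypeR R)) => //.
  apply/measurable_fun_pairP; split => /=.
    by apply: measurable_funM => //; exact: measurable_fst.
  by apply: measurable_funM => //; exact: measurable_snd.
have kappahom (x y r : R) : 0 < r ->
    kappa (r * x)%R (r * y)%R = ((r `^ (- alpha - 1))%:E * kappa x y)%E.
  by move=> r0; rewrite /kappa (mulrCA s r x) (mulrCA s r y); exact: khom.
have := quadrant_bound hp mkappa (fun x y => k0 _ _) kappahom mv mv a0 a0 va va.
apply: le_trans; apply: eqW.
under [in LHS]eq_integral do rewrite -kappaE.
rewrite -(integral_kernel_fold exponents_sum mkappa (fun x y => k0 _ _)
  (fun x y => ksym _ _) kappahom factor_ge0).
rewrite -ge0_integralZl//=.
- apply: eq_integral => t; rewrite mem_setE in_itv/= andbT => t0.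
  by rewrite pform_diag// EFinM muleA.
- apply: measurable_funTS; apply: emeasurable_funM.
    apply: measurableT_comp => //; apply: measurable_funM;
      by apply: measurable_funB => //; exact: measurable_powR.
  rewrite [X in measurable_fun _ X](_ : _ = fun t => k s (s * t)).
    exact: measurable_kernel_section.
  exact/funext.
- move=> t; rewrite in_itv/= andbT => t0.
  by rewrite mule_ge0 ?k0// lee_fin factor_ge0.
- by rewrite lee_fin powR_ge0.
Qed.

Let cross a := (\int[mu]_(t in `]0%R, +oo[) ((t `^ a)%:E * k 1%R (- t)%R))%E.

(** The kernel [k(x, -y)] is in general not symmetric, so its integral is not folded onto [(0, 1)];
    the four terms of [pform_powR] are integrated separately. *)
Lemma cross_bound v w a b m0 m1 mr ms :
  cross 0 = m0%:E -> cross (alpha - 1) = m1%:E ->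
  cross rho = mr%:E -> cross sigma = ms%:E ->
  measurable_fun [set: R] v ->
  measurable_fun [set: R] w -> 0 <= a -> 0 <= b ->
  (\int[mu]_(x in `]0%R, +oo[) (`|v x| `^ p * x `^ (- alpha))%:E =
    (a `^ p)%:E)%E ->
  (\int[mu]_(x in `]0%R, +oo[) (`|w x| `^ p * x `^ (- alpha))%:E =
    (b `^ p)%:E)%E ->
  ((a `^ p * m0 + b `^ p * m1
     - (a * b `^ (p - 1) * ms + b * a `^ (p - 1) * mr))%:E
   <= \int[mu]_(x in `]0%R, +oo[) \int[mu]_(y in `]0%R, +oo[)
     ((pform p (v x) (w y))%:E * k x (- y)%R))%E.
Proof.
move=> E0 E1 Er Es mv mw a0 b0 va wb; have [mk k0 ksym khom _] := hk.
pose kappa x y := k x (- y).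
have mkappa : measurable_fun [set: measurableTypeR R * measurableTypeR R]
    (fun z => kappa z.1 z.2).
  apply: (@measurableT_comp _ _ _ _ _ _ (fun z => k z.1 z.2) _
    (fun z : measurableTypeR R * measurableTypeR R =>
     (z.1, - z.2) : measurableTypeR R * measurableTypeR R)) => //.
  apply/measurable_fun_pairP; split => /=; first exact: measurable_fst.
  exact: (measurableT_comp (@oppr_measurable _ setT) measurable_snd).
have kappahom (x y r : R) : 0 < r ->
    kappa (r * x)%R (r * y)%R = ((r `^ (- alpha - 1))%:E * kappa x y)%E.
  by move=> r0; rewrite /kappa -mulrN khom.
apply: le_trans (quadrant_bound hp mkappa (fun x y => k0 _ _) kappahom
  mv mw a0 b0 va wb).
rewrite -/rho.
have mk1 : measurable_fun [set: R] (fun t => k 1 (- t)).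
  by under eq_fun do rewrite -mulN1r; exact: measurable_kernel_section.
have mpk (f : R -> R) : measurable_fun [set: R] f ->
    measurable_fun [set: R] (fun t => (f t)%:E * k 1%R (- t)%R)%E.
  by move=> mf; apply: emeasurable_funM => //; exact: measurableT_comp.
have mpow c : measurable_fun [set: R] (fun t : R => t `^ c).
  exact: measurable_powR.
have intpow c e m : 0 <= c -> cross e = m%:E ->
    (\int[mu]_(t in `]0%R, +oo[) ((c * t `^ e)%:E * k 1%R (- t)%R) =
     (c * m)%:E)%E.
  move=> c0 Em; rewrite EFinM -Em -ge0_integralZl//=.
  - by apply: eq_integral => t _; rewrite EFinM muleA.
  - by apply: measurable_funTS; exact: mpk.
  - by move=> t _; rewrite mule_ge0// lee_fin powR_ge0.
have intpow2 c e m c' e' m' : 0 <= c -> cross e = m%:E -> 0 <= c' ->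
    cross e' = m'%:E ->
    (\int[mu]_(t in `]0%R, +oo[)
       ((c * t `^ e + c' * t `^ e')%:E * k 1%R (- t)%R) =
     (c * m + c' * m')%:E)%E.
  move=> c0 Em c'0 Em'; rewrite EFinD.
  rewrite -(intpow _ _ _ c0 Em) -(intpow _ _ _ c'0 Em') -ge0_integralD//=.
  - apply: eq_integral => t _.
    by rewrite EFinD ge0_muleDl// lee_fin mulr_ge0// powR_ge0.
  - by move=> t _; rewrite mule_ge0// lee_fin mulr_ge0// powR_ge0.
  - by apply: measurable_funTS; apply: mpk; exact: measurable_funM.
  - by move=> t _; rewrite mule_ge0// lee_fin mulr_ge0// powR_ge0.
  - by apply: measurable_funTS; apply: mpk; exact: measurable_funM.
have ab0 : 0 <= a * b `^ (p - 1) by rewrite mulr_ge0// powR_ge0.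
have ba0 : 0 <= b * a `^ (p - 1) by rewrite mulr_ge0// powR_ge0.
have EP := intpow2 _ _ _ _ _ _ (powR_ge0 a p) E0 (powR_ge0 b p) E1.
have EN := intpow2 _ _ _ _ _ _ ab0 Es ba0 Er.
move: EP EN; move: (_ * m0 + _) (_ * ms + _) => P N EP EN.
(* With [N] on the other side, the claim becomes an equality between integrals of nonnegative
   functions, and no difference of possibly infinite quantities occurs. *)
rewrite EFinB leeBlDr// -EP -EN -ge0_integralD//=; last 4 first.
- by move=> t _; rewrite mule_ge0// ?k0// lee_fin pform_ge0.
- apply: measurable_funTS; apply: (@mpk (fun t => pform p a (t `^ rho * b))).
  by apply: measurable_pform => //; apply: measurable_funM => //; exact: mpow.
- by move=> t _; rewrite mule_ge0// lee_fin addr_ge0// mulr_ge0// powR_ge0.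
- apply: measurable_funTS; apply: mpk.
  by apply: measurable_funD; exact: measurable_funM.
apply/eqW/eq_integral => t.
rewrite mem_setE in_itv/= andbT => t0.
rewrite /kappa -ge0_muleDl; last 2 first.
- by rewrite lee_fin pform_ge0.
- by rewrite lee_fin addr_ge0// mulr_ge0// powR_ge0.
rewrite -EFinD; congr (_%:E * _)%E.
by rewrite pform_powR// powRr0; ring.
Qed.

End assembly.

(** * The two sides of the inequality *)

(** The constants [d1] and [d2] carry no sign, so linearity is drawn from the integrability of the
    two restrictions of [f]. *)
Lemma integral_two_sided (R : realType) (f : R -> R) (d1 d2 A B : R) :
  measurable_fun [set: R] f -> (forall x, 0 <= f x) ->
  (\int[@lebesgue_measure R]_(x in `]0%R, +oo[) (f x)%:E = A%:E)%E ->
  (\int[@lebesgue_measure R]_(x in `]-oo, 0%R[) (f x)%:E = B%:E)%E ->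
  (\int[@lebesgue_measure R]_x
     (if 0 < x then d1 * f x else if x < 0 then d2 * f x else 0)%R%:E =
   (d1 * A + d2 * B)%:E)%E.
Proof.
move=> mf f0 fA fB.
have int (D : set R) C : measurable D ->
    (\int[@lebesgue_measure R]_(x in D) (f x)%:E = C%:E)%E ->
    lebesgue_measure.-integrable [set: R] ((EFin \o f) \_ D) /\
    (\int[@lebesgue_measure R]_x (((EFin \o f) \_ D) x) = C%:E)%E.
  move=> mD fC; rewrite -integral_mkcond; split => //.
  apply/integrableP; split.
    apply/(measurable_restrictT _ _).1 => //; apply: measurable_funTS.
    exact: measurableT_comp.
  rewrite [ltLHS](_ : _ = C%:E) ?ltry// -fC [RHS]integral_mkcond.
  apply: eq_integral => x _; rewrite gee0_abs//.
  by apply: erestrict_ge0 => y _; rewrite lee_fin.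
have [iA eA] := int _ _ (measurable_itv _) fA.
have [iB eB] := int _ _ (measurable_itv _) fB.
rewrite EFinD !EFinM -eA -eB -!integralZl//= -integralD//=.
- apply: eq_integral => x _; rewrite /patch !mem_setE !in_itv/= andbT.
  case: (ltgtP 0 x) => _; rewrite ?mule0 ?adde0 ?add0e ?EFinM//.
- exact: integrableZl.
- exact: integrableZl.
Qed.

Theorem corollary3p8 (R : realType) (alpha p : R) (k : R -> R -> \bar R)
    (u : R -> R) (halpha : 0 < alpha < 2) (hp : 1 < p)
    (hk : kernel_class alpha k) (hu : weighted_Lp alpha p u) :
  (\int[@lebesgue_measure R]_x ((`|u x| `^ p)%:E * W alpha k p 1 x)
     + G_remainder alpha k p u <= energy k p u)%E.
Proof.
have [mk k0 ksym khom _] := hk; have [mu uoo] := hu.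
set q := conj_exp p; pose rho := (alpha - 1) / p; pose sigma := (alpha - 1) / q.
have p0 : 0 < p by exact: lt_trans hp.
have sums : rho + sigma = alpha - 1 by exact: exponents_sum.
have signs := exponents_sign alpha hp; rewrite -/rho -/q -/sigma in signs.
have qV : q^-1 = 1 - p^-1 by rewrite -(conj_expV hp) addrAC subrr add0r.
have powR1r c : (1 : R) `^ c = 1 by rewrite powR1.
pose f x := `|u x| `^ p * `|x| `^ (- alpha).
have mf : measurable_fun [set: R] f.
  apply: measurable_funM.
    apply: (measurableT_comp (measurable_powR _)); exact: measurableT_comp.
  apply: (measurableT_comp (measurable_powR _)); exact: normr_measurable.
have f0 x : 0 <= f x by rewrite mulr_ge0// powR_ge0.
have mEf : measurable_fun [set: R] (EFin \o f) by exact: measurableT_comp.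
(* Taking the [p]-th root once turns the fractional powers of [I_+] and [I_-] in G into [a], [b],
   [a^(p-1)] and [b^(p-1)]. *)
have norm_exists (D : set R) : measurable D -> exists2 a, 0 <= a &
    (\int[@lebesgue_measure R]_(x in D) (f x)%:E = (a `^ p)%:E)%E.
  move=> mD.
  have I0 : (0 <= \int[@lebesgue_measure R]_(x in D) (f x)%:E)%E.
    by apply: integral_ge0 => x _; rewrite lee_fin.
  have Ioo : (\int[@lebesgue_measure R]_(x in D) (f x)%:E < +oo)%E.
    apply: le_lt_trans uoo; apply: ge0_subset_integral => //.
    by move=> x _; rewrite lee_fin.
  have Ifin : (\int[@lebesgue_measure R]_(x in D) (f x)%:E)%E \is a fin_num.
    by rewrite ge0_fin_numE.
  exists (fine (\int[@lebesgue_measure R]_(x in D) (f x)%:E)%E `^ p^-1).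
    exact: powR_ge0.
  by rewrite -powRrM mulVf ?gt_eqF// powRr1 ?fine_ge0// fineK.
have [a a0 Ia] := norm_exists _ (measurable_itv `]0, +oo[).
have [b b0 Ib] := norm_exists _ (measurable_itv `]-oo, 0[).
have ua : (\int[@lebesgue_measure R]_(x in `]0%R, +oo[)
    (`|u x| `^ p * x `^ (- alpha))%:E = (a `^ p)%:E)%E.
  rewrite -Ia; apply: eq_integral => x; rewrite mem_setE in_itv/= andbT => x0.
  by rewrite /f (gtr0_norm x0).
have ub : (\int[@lebesgue_measure R]_(x in `]0%R, +oo[)
    (`|u (- x)%R| `^ p * x `^ (- alpha))%:E = (b `^ p)%:E)%E.
  transitivity (\int[@lebesgue_measure R]_(x in `]0%R, +oo[)
      (EFin \o f) (- x)%R)%E.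
    apply: eq_integral => x; rewrite mem_setE in_itv/= andbT => x0.
    by rewrite /f /= normrN (gtr0_norm x0).
  rewrite -Ib; apply/esym; apply: (ge0_integral_neg_pos mEf) => x.
  by rewrite lee_fin.
have muN : measurable_fun [set: R] (fun x => u (- x)).
  by apply: (measurableT_comp mu); exact: oppr_measurable.
pose cross c := (\int[@lebesgue_measure R]_(t in `]0%R, +oo[)
  ((t `^ c)%:E * k 1%R (- t)%R))%E.
have crossE c : - 1 < c < alpha -> exists m, cross c = m%:E.
  move=> cal; exists (fine (cross c)).
  by rewrite fineK// (cross_integral_fin halpha hk cal).
(* All four exponents lie between 0 and [alpha - 1], hence in [(-1, alpha)]. *)
have [m0 E0] : exists m, cross 0 = m%:E by apply: crossE; lra.
have [m1 E1] : exists m, cross (alpha - 1) = m%:E by apply: crossE; lra.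
have [mr Er] : exists m, cross rho = m%:E.
  by apply: crossE; case: signs; lra.
have [ms Es] : exists m, cross sigma = m%:E.
  by apply: crossE; case: signs; lra.
pose h t := (1 - t `^ rho) * (1 - t `^ sigma).
pose gam s := (\int[@lebesgue_measure R]_(t in `]0%R, 1%R[)
  ((h t)%:E * k s (s * t)%R))%E.
have gamE s : `|s| = 1 -> exists g, gam s = g%:E.
  move=> s1; exists (fine (gam s)).
  by rewrite fineK// (radial_integral_fin halpha hp hk).
have [gp Ep] := gamE 1 (normr1 _).
have [gm Em] : exists g, gam (- 1) = g%:E by apply: gamE; rewrite normrN1.
have flip c := integral_kernel_flip c mk k0 ksym khom.
have int_plus : (\int[@lebesgue_measure R]_(t in `]0%R, +oo[) k 1%R (- t)%R =
    m0%:E)%E.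
  by rewrite -E0; apply: eq_integral => t _; rewrite powRr0 mul1e.
have int_minus : (\int[@lebesgue_measure R]_(t in `]0%R, +oo[) k (-1)%R t =
    m1%:E)%E.
  rewrite -E1 /cross -(subr0 (alpha - 1)) -flip.
  by apply: eq_integral => t _; rewrite powRr0 mul1e.
have flip_rho : (\int[@lebesgue_measure R]_(t in `]0%R, +oo[)
    ((t `^ rho)%:E * k (-1)%R t) = ms%:E)%E.
  by rewrite flip -sums addrAC subrr add0r.
have flip_sigma : (\int[@lebesgue_measure R]_(t in `]0%R, +oo[)
    ((t `^ sigma)%:E * k (-1)%R t) = mr%:E)%E.
  by rewrite flip -sums addrK.
(* Since [alpha - 1 - rho = sigma], exchanging [rho] and [sigma] only swaps the two factors of the
   integrand. *)
have gamma_plusE : gamma_plus alpha k rho = gp%:E /\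
    gamma_plus alpha k sigma = gp%:E.
  rewrite -Ep /gamma_plus /gam /h -sums addrK addrAC subrr add0r; split.
    by apply: eq_integral => t _; rewrite mul1r.
  by apply: eq_integral => t _; rewrite mul1r mulrC.
have gamma_minusE : gamma_minus alpha k rho = gm%:E /\
    gamma_minus alpha k sigma = gm%:E.
  rewrite -Em /gamma_minus /gam /h -sums addrK addrAC subrr add0r; split.
    by apply: eq_integral => t _; rewrite mulN1r.
  by apply: eq_integral => t _; rewrite mulN1r mulrC.
have D_plusE : D_plus alpha k p 1 (alpha - 1) =
    (gp + m0 - (p^-1 * ms + q^-1 * mr))%:E.
  rewrite /D_plus /C_plus -/q -[_ / p]/rho -[_ / q]/sigma !powR1r.
  rewrite (proj1 gamma_plusE) (proj2 gamma_plusE) int_plus.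
  rewrite -/(cross rho) -/(cross sigma) Er Es !mul1e.
  rewrite -!EFinB -!EFinM -EFinD; congr EFin.
  by rewrite qV; ring.
have D_minusE : D_minus alpha k p 1 (alpha - 1) =
    (gm + m1 - (p^-1 * mr + q^-1 * ms))%:E.
  rewrite /D_minus /C_minus -/q -[_ / p]/rho -[_ / q]/sigma !powR1r invr1.
  rewrite (proj1 gamma_minusE) (proj2 gamma_minusE) int_minus.
  rewrite flip_rho flip_sigma !mul1e.
  rewrite -!EFinB -!EFinM -EFinD; congr EFin.
  by rewrite qV; ring.
have potentialE : (\int[@lebesgue_measure R]_x
      ((`|u x| `^ p)%:E * W alpha k p 1 x) =
    ((gp + m0 - (p^-1 * ms + q^-1 * mr)) * a `^ p +
     (gm + m1 - (p^-1 * mr + q^-1 * ms)) * b `^ p)%:E)%E.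
  rewrite -(integral_two_sided _ _ mf f0 Ia Ib); apply: eq_integral => x _.
  rewrite /W D_plusE D_minusE /f; case: ifP => _.
    by rewrite -!EFinM mulrA mulrC.
  by case: ifP => _; [rewrite -!EFinM mulrA mulrC|rewrite mule0].
have remainderE : G_remainder alpha k p u =
    (ms * (p^-1 * a `^ p + q^-1 * b `^ p - a * b `^ (p - 1)) +
     mr * (q^-1 * a `^ p + p^-1 * b `^ p - b * a `^ (p - 1)))%:E.
  have root c : 0 <= c -> (c `^ p) `^ p^-1 = c /\
      (c `^ p) `^ q^-1 = c `^ (p - 1).
    move=> c0; rewrite -!powRrM divff ?gt_eqF// powRr1//; split => //.
    by rewrite /q /conj_exp invf_div mulrC divfK// gt_eqF.
  rewrite /G_remainder /l_exp -/q -/(cross sigma) -/(cross rho) Er Es.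
  rewrite /I_plus /I_minus Ia Ib !poweR_EFin.
  have [-> ->] := root _ a0; have [-> ->] := root _ b0.
  by rewrite (mulrC b).
have energyE : energy k p u = ((2^-1)%:E * \int[@lebesgue_measure R]_x
  \int[@lebesgue_measure R]_y ((pform p (u x) (u y))%:E * k x y))%E by [].
rewrite potentialE remainderE energyE integral_quadrants; last 2 first.
- apply: emeasurable_funM => //; apply: measurableT_comp => //.
  apply: measurable_pform.
    exact: (measurableT_comp mu measurable_fst).
  exact: (measurableT_comp mu measurable_snd).
- by move=> x y; rewrite mule_ge0// lee_fin pform_ge0.
set Qpp := (X in (X + _ + _)%E); set Qpm := (X in (_ + X + _)%E).
set Qmp := (X in (_ + (X + _))%E); set Qmm := (X in (_ + (_ + X))%E).
have Bpp : ((a `^ p * (2 * gp))%:E <= Qpp)%E.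
  have := diag_bound hp hk (normr1 _) mu a0 ua.
  rewrite -/(gam 1) Ep -!EFinM => /le_trans; apply.
  apply: eqW.
  apply: eq_integral => x _; apply: eq_integral => y _.
  by rewrite !mul1r.
have Bmm : ((b `^ p * (2 * gm))%:E <= Qmm)%E.
  have := diag_bound hp hk (normrN1 _) muN b0 ub.
  rewrite -/(gam (- 1)) Em -!EFinM => /le_trans; apply.
  apply: eqW.
  apply: eq_integral => x _; apply: eq_integral => y _.
  by rewrite !mulN1r.
have Bpm := cross_bound hp hk E0 E1 Er Es mu muN a0 b0 ua ub.
rewrite -/Qpm in Bpm.
(* Both the form and the kernel are symmetric in their two arguments, so exchanging the variables
   identifies the mixed quadrants and one cross bound serves both. *)
have QmpE : Qmp = Qpm.
  rewrite /Qmp (@tonelli_pos _ (fun x y =>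
    (pform p (u (- x)) (u y))%:E * k (- x)%R y)%E).
  - apply: eq_integral => x _; apply: eq_integral => y _.
    rewrite ksym; congr (_%:E * _)%E.
    by rewrite /pform -mulrNN !opprB.
  - apply: emeasurable_funM.
      apply: measurableT_comp => //; apply: measurable_pform.
        exact: (measurableT_comp muN measurable_fst).
      exact: (measurableT_comp mu measurable_snd).
    apply: (@measurableT_comp _ _ _ _ _ _ (fun z => k z.1 z.2) _
      (fun z : measurableTypeR R * measurableTypeR R =>
       (- z.1, z.2) : measurableTypeR R * measurableTypeR R)) => //.
    apply/measurable_fun_pairP; split => /=; last exact: measurable_snd.
    exact: (measurableT_comp (@oppr_measurable _ setT) measurable_fst).
  - by move=> x y _ _; rewrite mule_ge0// lee_fin pform_ge0.
rewrite QmpE -EFinD.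
have := leeD (leeD Bpp Bpm) (leeD Bpm Bmm).
have half0 : (0 <= (2^-1 : R)%:E)%E by rewrite lee_fin invr_ge0.
move/(lee_wpmul2l half0); apply: le_trans.
(* Both sides are equal: the factor 1/2 absorbs the doubling in the diagonal and in the mixed
   quadrants, and the terms [ms / p], [mr / q] and their mirror images in the potential cancel the
   linear part of G. *)
rewrite -!EFinD -EFinM lee_fin; apply: eqW.
rewrite qV; move: (a `^ p) (b `^ p) (a `^ (p - 1)) (b `^ (p - 1)) (p^-1).
by clear; move=> A B A' B' P; field.
Qed.
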